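(* Suppose that $1<q\le p<\infty$. Let $\phi\in\mathcal{G}_{q,p}$ be a surjective function $(0,\infty)\to(0,\infty)$ such that there is a constant $C>0$ with $$\int_{r}^{\infty}\phi^{q}(t)\,t^{\frac{dq}{p}-1}\,dt\le C\,\phi^{q}(r)\,r^{\frac{dq}{p}}\quad\text{for every } r>0.$$ Let $\rho:(0,\infty)\to(0,\infty)$ satisfy the doubling condition: there is a constant $C_1>0$ such that for all $r,s>0$, $$\frac12\le\frac rs\le2\ \Longrightarrow\ \frac1{C_1}\le\frac{\rho(r)}{\rho(s)}\le C_1 .$$ Let $\bar q,\bar p$ be positive real exponents with $\frac{q}{\bar q}=\frac{p}{\bar p}<1$. Assume that there is a constant $C'>0$ such that for every $r>0$, $$\int_{0}^{r}\frac{\rho(t)}{t}\,dt\le C'\,\phi(r)^{\frac{q}{\bar q}-1}\qquad\text{and}\qquad \int_{r}^{\infty}\frac{\rho(t)\phi(t)}{t}\,dt\le C'\,\phi(r)^{\frac{q}{\bar q}} .$$ Put $\psi(r)=(\phi(r))^{\frac{q}{\bar q}}$ for $r>0$. Then there is a constant $K>0$ such that for all $f\in(L^{q},L^{p})^{\phi}(\mathbb{R}^{d})$, $$\|T_{\rho}f\|_{(L^{\bar q},L^{\bar p})^{\psi}(\mathbb{R}^{d})}\le K\,\|f\|_{(L^{q},L^{p})^{\phi}(\mathbb{R}^{d})}.$$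
   Context: Convention: $\frac1\infty=0$. $L^{0}(\mathbb{R}^{d})$ is the space of (a.e. equivalence classes of) Lebesgue measurable complex-valued functions on $\mathbb{R}^d$; $B(y,r)$ is the open ball with center $y\in\mathbb{R}^d$ and radius $r>0$. For $1\le q\le p\le\infty$, $\mathcal{G}_{q,p}$ is the set of all functions $\phi:(0,\infty)\to(0,\infty)$ such that $t\mapsto\phi(t)t^{d/p}$ is almost decreasing (there is $C>0$ with $\phi(s)s^{d/p}\le C\phi(r)r^{d/p}$ whenever $0<r\le s<\infty$) and $t\mapsto\phi(t)t^{d/q}$ is almost increasing (there is $C>0$ with $\phi(r)r^{d/q}\le C\phi(s)s^{d/q}$ whenever $0<r\le s<\infty$). For $r>0$ and $f\in L^0(\mathbb{R}^d)$, put ${}_{r}\|f\|_{q,p}=\left\|\left[\int_{\mathbb{R}^d}|f\chi_{B(y,r)}|^{q}(x)\,dx\right]^{1/q}\right\|_{p}$, the $L^{p}(\mathbb{R}^d)$-norm being taken in the variable $y$ (usual modification if $q=\infty$). For $\phi\in\mathcal{G}_{q,p}$ the generalized Fofana space $(L^{q},L^{p})^{\phi}(\mathbb{R}^{d})$ is the set of all $f\in L^{0}(\mathbb{R}^{d})$ with $$\|f\|_{(L^{q},L^{p})^{\phi}(\mathbb{R}^{d})}=\sup_{r>0}\frac{1}{\phi(r)}\,r^{d(-\frac1q-\frac1p)}\;{}_{r}\|f\|_{q,p}<\infty.$$ For $\rho:(0,\infty)\to(0,\infty)$, the generalized fractional integral operator is $T_{\rho}f(x)=\int_{\mathbb{R}^{d}}\frac{\rho(|x-y|)}{|x-y|^{d}}f(y)\,dy$,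 $x\in\mathbb{R}^d$. *)

(* Defs.v *)
From HB Require Import structures.
From mathcomp Require Import all_boot all_order all_algebra.
From mathcomp Require Import complex.
From mathcomp Require Import all_classical all_reals all_analysis.
From mathcomp Require Import measurable_realfun.

Set Implicit Arguments.
Unset Strict Implicit.
Unset Printing Implicit Defensive.
Import Order.TTheory GRing.Theory Num.Theory.
Import numFieldNormedType.Exports.

Local Open Scope classical_set_scope.
Local Open Scope ring_scope.

(* Tuples carry the product sigma-algebra, i.e. the Borel sets of R^d. *)
Notation point R d := (d.-tuple (measurableTypeR R)).

Section lebesgue_measure_Rd.
Variable R : realType.
Local Open Scope ereal_scope.

Definition cons_point d (z : measurableTypeR R * point R d) : point R d.+1 :=
  [the d.+1.-tuple _ of z.1 :: z.2].

Definition uncons_point d (x : point R d.+1) : measurableTypeR R * point R d :=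
  (thead x, [tuple of behead x]).

Lemma cons_pointK d : cancel (@cons_point d) (@uncons_point d).
Proof. by case=> a x; congr pair; apply: val_inj. Qed.

Lemma measurable_cons_point d : measurable_fun setT (@cons_point d).
Proof. exact: measurable_cons. Qed.

Lemma measurable_uncons_point d : measurable_fun setT (@uncons_point d).
Proof.
apply/measurable_fun_pairP; split; first exact: measurable_tnth.
exact: measurable_behead.
Qed.

Section step.
Variables (d : nat) (mu : {sigma_finite_measure set (point R d) -> \bar R}).

Definition lebesgue_step : set (point R d.+1) -> \bar R :=
  pushforward ((@lebesgue_measure R) \x mu) (@cons_point d).

Let mcons := @measurable_cons_point d.

Let step0 : lebesgue_step set0 = 0.
Proof. by rewrite /lebesgue_step /pushforward preimage_set0 measure0. Qed.

Let step_ge0 A : 0 <= lebesgue_step A.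
Proof. exact: measure_ge0. Qed.

Let step_sigma_additive : semi_sigma_additive lebesgue_step.
Proof. exact: measure_semi_sigma_additive. Qed.

HB.instance Definition _ := isMeasure.Build _ _ _ lebesgue_step
  step0 step_ge0 step_sigma_additive.

Let step_sigma_finite : sigma_finite setT lebesgue_step.
Proof.
have /sigma_finiteP[F [TF ndF Foo]] := sigma_finiteT (@lebesgue_measure R).
have /sigma_finiteP[G [TG ndG Goo]] := sigma_finiteT mu.
exists (fun i => @uncons_point d @^-1` (F i `*` G i)).
  rewrite -preimage_bigcup (_ : \bigcup_i _ = setT) ?preimage_setT//.
  apply/seteqP; split => // -[a x] _.
  have [i _ Fa] : (\bigcup_i F i) a by rewrite -TF.
  have [j _ Gx] : (\bigcup_i G i) x by rewrite -TG.
  exists (maxn i j) => //; split => /=.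
    by move: a Fa; exact/subsetPset/ndF/leq_maxl.
  by move: x Gx; exact/subsetPset/ndG/leq_maxr.
move=> i; have [mFi Fioo] := Foo i; have [mGi Gioo] := Goo i; split.
  rewrite -[X in measurable X]setTI; apply: measurable_uncons_point => //.
  exact: measurableX.
rewrite /lebesgue_step /pushforward -comp_preimage.
rewrite (_ : _ \o _ = id) ?preimage_id//; last first.
  by apply/funext => z /=; rewrite cons_pointK.
by rewrite product_measure1E// lte_mul_pinfty// ge0_fin_numE.
Qed.

HB.instance Definition _ := Measure_isSigmaFinite.Build _ _ _ lebesgue_step
  step_sigma_finite.

End step.

Fixpoint lebesgueRd d : {sigma_finite_measure set (point R d) -> \bar R} :=
  if d is d'.+1 then lebesgue_step (lebesgueRd d')
  else dirac ([tuple] : point R 0).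

Lemma lebesgueRd_box d (A : 'I_d -> set (measurableTypeR R)) :
  (forall i, measurable (A i)) ->
  lebesgueRd d [set x | forall i, A i (tnth x i)] =
  \prod_(i < d) lebesgue_measure (A i).
Proof.
elim: d A => [|d IH] A mA /=.
  rewrite big_ord0 /dirac/= indicE mem_set// => -[] //.
rewrite big_ord_recl -IH//= -product_measure1E//; last first.
  rewrite (_ : [set _ | _] = \bigcap_(i in [set: 'I_d])
      ((@tnth _ (measurableTypeR R))^~ i @^-1` A (lift ord0 i))); last first.
    by apply/seteqP; split => x /= h i //=; exact: h.
  apply: fin_bigcap_measurable => // i _.
  by rewrite -[X in measurable X]setTI; exact: measurable_tnth.
congr (product_measure1 _ _ _); apply/seteqP; split => -[a x] /=.
  move=> h; split; first exact: (h ord0).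
  by move=> i; have := h (lift ord0 i); rewrite tnthS.
move=> [Aa Ax] i; case: (unliftP ord0 i) => [j|] ->//.
by rewrite tnthS; exact: Ax.
Qed.

End lebesgue_measure_Rd.

Definition edist (R : realType) d (x y : point R d) : R :=
  Num.sqrt (\sum_(i < d) (tnth x i - tnth y i : R) ^+ 2).

Definition eball (R : realType) d (y : point R d) (r : R) : set (point R d) :=
  [set x | edist x y < r].

(* Measurability with respect to the completion of mu.  For f >= 0 measurable
   in this sense, the supremum over measurable simple functions below f by which
   [\int[mu]_x f x] is defined equals the integral of f for the completed
   measure (and likewise for the positive and negative parts of a signed f), so
   integrals below are taken with the uncompleted mu. *)
Definition completed_measurable_fun disp (T : measurableType disp)
    (R : realType) (mu : {measure set T -> \bar R}) (D : set T) (f : T -> R) :=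
  measurable_fun (D : set (g_sigma_algebraType (completed_algebra_gen mu)))
    (f : _ -> measurableTypeR R).

Section fofana.
Variables (R : realType) (d : nat).
Local Notation mu := (lebesgueRd R d).
Local Notation dR := (d%:R : R).
Implicit Types (phi rho : R -> R) (q p : \bar R) (f : point R d -> R[i]).

Definition cmod (z : R[i]) : R := ComplexField.Normc.normc z.

Definition L0 : set (point R d -> R[i]) :=
  [set f | completed_measurable_fun mu setT (fun x => complex.Re (f x)) /\
           completed_measurable_fun mu setT (fun x => complex.Im (f x))].

(* 1/p, with 1/oo = 0 since [fine +oo] = 0 and 0^-1 = 0. *)
Definition einv p : R := (fine p)^-1.

(* Functions on (0,oo) are functions on R of which only the values at positive
   arguments matter. *)
Definition pos_valued phi := forall t, 0 < t -> 0 < phi t.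

Definition almost_decreasing (g : R -> R) :=
  exists2 C : R, 0 < C & forall r s, 0 < r -> r <= s -> g s <= C * g r.

Definition almost_increasing (g : R -> R) :=
  exists2 C : R, 0 < C & forall r s, 0 < r -> r <= s -> g r <= C * g s.

Definition Gclass q p : set (R -> R) :=
  [set phi | [/\ pos_valued phi,
    almost_decreasing (fun t => phi t * t `^ (dR * einv p)) &
    almost_increasing (fun t => phi t * t `^ (dR * einv q))]].

Definition amalgam_norm (r : R) q p f : \bar R :=
  Lnorm mu p (fun y =>
    Lnorm mu q (fun x => (cmod (f x) * \1_(eball y r) x)%:E)).

Definition fofana_norm phi q p f : \bar R :=
  ereal_sup [set ((phi r)^-1 * r `^ (dR * (- einv q - einv p)))%:E *
                 amalgam_norm r q p f | r in [set s : R | 0 < s]%R]%E.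

Definition fofana_space phi q p : set (point R d -> R[i]) :=
  [set f | L0 f /\ (fofana_norm phi q p f < +oo)%E].

Definition frac_kernel rho (x y : point R d) : R :=
  rho (edist x y) / edist x y ^+ d.

(* Meaningful at x when T_rho |f| (x) is finite, see [T_rho_defined]. *)
Definition T_rho rho f : point R d -> R[i] := fun x =>
  Complex (\int[mu]_y (frac_kernel rho x y * complex.Re (f y)))%R
          (\int[mu]_y (frac_kernel rho x y * complex.Im (f y)))%R.

Definition T_rho_defined rho f (x : point R d) : Prop :=
  (\int[mu]_y (frac_kernel rho x y * cmod (f y))%:E < +oo)%E.

Definition doubling rho :=
  exists2 C : R, 0 < C & forall r s, 0 < r -> 0 < s ->
    2^-1 <= r / s <= 2 -> C^-1 <= rho r / rho s <= C.

End fofana.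

(* Main.v *)
Require Import Defs.
From HB Require Import structures.
From mathcomp Require Import all_boot all_order all_algebra.
From mathcomp Require Import complex.
From mathcomp Require Import all_classical all_reals all_analysis.
From mathcomp Require Import measurable_realfun.
From mathcomp Require Import ring lra.

Set Implicit Arguments.
Unset Strict Implicit.
Unset Printing Implicit Defensive.
Import Order.TTheory GRing.Theory Num.Theory.
Import numFieldNormedType.Exports.

Local Open Scope classical_set_scope.
Local Open Scope ring_scope.

Local Notation Rd R d := (d.-tuple (measurableTypeR R)).
Local Notation edist := Defs.edist.

(* The maximal function is avoided.  With W(y, t) the integral of |f|^q over
   B(y, t), the Fofana norm bounds the L^(p/q) norm of W(-, t) for each t, hence
   also W pointwise.  Doubling of rho turns the kernel into an average over
   balls, so T_rho f(x) is controlled by ball averages of |f| alone, and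
   Hedberg's splitting at the radius s with phi(s) equal to a prescribed level
   (this is where surjectivity enters) gives pointwise and weak-type bounds;
   summing the latter over levels yields a strong-type inequality without the
   maximal theorem.  On B(y, r) the part of f inside B(y, 2r) is treated by the
   strong-type inequality, and the rest pointwise through an average of the
   t^(-d) W(y, t) over t > r, whose integral in y is the tail integral of
   phi^p t^(d-1). *)

(** Measurability shapes much of the development: [rho] and [f] are measurable only for the
    completed measure and [phi] carries no measurability hypothesis, whereas Tonelli needs Borel
    integrands. Hence [f] is replaced by a Borel representative, [phi] by a comparable Borel
    function, and [rho] by a Borel [rho0 <= rho] that agrees with it off a null set [N] of radii.
    The last exchange leaves every [T_rho f x] unchanged because the points whose distance to [x]
    lies in [N] form a null set. With [e = q / qb], balancing near and far parts gives [A^e M^(1-e)]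
    when the ball averages are at most [A] and at most [M phi]. Its power [q / e = qb] is
    [A^q M^(q/e-q)]: this is where the exponent [q] in the strong-type inequality comes from, and
    why the final power of [M] is [p / e = pb]. The exterior part on [B(y, r)] involves all larger
    radii at once. A supremum over them would bring a maximal function back; an integral over them
    commutes with the integral in [y]. *)

(** * Integrals of functions not known to be measurable *)

Section nonmeasurable_integrands.
Context disp (T : measurableType disp) (R : realType).
Variable mu : {measure set T -> \bar R}.
Local Open Scope ereal_scope.
Import HBNNSimple.

(* The integral of a nonnegative function is the supremum over the simple
   functions below it, and zeroing these on a null set does not change their
   integrals; hence no measurability assumption on [f] and [g]. *)
Lemma le_integral_off_null (D N : set T) (f g : T -> \bar R) :
  measurable N -> mu N = 0 ->
  (forall x, D x -> 0 <= f x) -> (forall x, D x -> 0 <= g x) ->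
  (forall x, D x -> ~ N x -> f x <= g x) ->
  \int[mu]_(x in D) f x <= \int[mu]_(x in D) g x.
Proof.
move=> mN N0 f0 g0 fg; rewrite (ge0_integralE _ f0) (ge0_integralE _ g0).
apply: ge_ereal_sup => /= _ [h hf <-].
have mNC : measurable (~` N) by exact: measurableC.
pose k := (proj_nnsfun h mNC).
have kE x : (k x = h x * (x \in ~` N)%:R)%R by rewrite -indicE.
have kN x : N x -> k x = 0%R by move=> Nx; rewrite kE memNset ?mulr0//; apply.
have kNC x : ~ N x -> k x = h x by move=> nNx; rewrite kE mem_set ?mulr1.
have -> : sintegral mu h = sintegral mu k.
  rewrite -!integralT_nnsfun; apply: ge0_ae_eq_integral => //.
  - exact/measurable_EFinP.
  - exact/measurable_EFinP.
  - by move=> x _; rewrite lee_fin.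
  - by move=> x _; rewrite lee_fin.
  exists N; split => // x /= /not_implyP[_].
  case: (pselect (N x)) => // nNx; case.
  by rewrite -[RHS]/((k x)%:E) kNC.
apply: ereal_sup_ubound; exists k => // x.
have [Nx|nNx] := pselect (N x).
  by rewrite kN//; exact: erestrict_ge0.
rewrite kNC// (le_trans (hf x))// !patchE.
case: ifPn => [|//]; rewrite inE => Dx; exact: fg.
Qed.

Lemma le_integral_nonneg (D : set T) (f g : T -> \bar R) :
  (forall x, D x -> 0 <= f x) -> (forall x, D x -> f x <= g x) ->
  \int[mu]_(x in D) f x <= \int[mu]_(x in D) g x.
Proof.
move=> f0 fg; apply: (@le_integral_off_null _ set0) => //.
- by move=> x Dx; rewrite (le_trans (f0 x Dx))// fg.
- by move=> x Dx _; exact: fg.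
Qed.

Lemma eq_integral_off_null (D N : set T) (f g : T -> \bar R) :
  measurable N -> mu N = 0 -> (forall x, D x -> ~ N x -> f x = g x) ->
  \int[mu]_(x in D) f x = \int[mu]_(x in D) g x.
Proof.
move=> mN N0 fg; rewrite (integralE mu D f) (integralE mu D g).
congr (_ - _); apply/eqP; rewrite eq_le; apply/andP; split;
  apply: (@le_integral_off_null _ N) => // x Dx.
all: by rewrite ?funepos_ge0 ?funeneg_ge0// => nNx;
  rewrite ?funeposE ?funenegE fg.
Qed.

(** Dividing a simple function below [c * f] by [c] gives one below [f]. The inequality thus holds
    for integrands such as powers of [phi], whose measurability is not known. *)
Lemma integralZl_le_nonneg (D : set T) (c : R) (f : T -> \bar R) : (0 < c)%R ->
  (forall x, D x -> 0 <= f x) ->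
  \int[mu]_(x in D) (c%:E * f x) <= c%:E * \int[mu]_(x in D) f x.
Proof.
move=> c0 f0; have ci : (0 <= c^-1)%R by rewrite invr_ge0 ltW.
rewrite (ge0_integralE _ f0) ge0_integralE; last first.
  by move=> x /f0 fx; rewrite mule_ge0// lee_fin ltW.
apply: ge_ereal_sup => /= _ [h hf <-].
have -> : sintegral mu h = c%:E * sintegral mu (scale_nnsfun h ci).
  by rewrite sintegralrM muleA -EFinM divff ?mul1e// gt_eqF.
apply: lee_wpmul2l; first by rewrite lee_fin ltW.
apply: ereal_sup_ubound; exists (scale_nnsfun h ci) => //= x.
rewrite mulrC EFinM lee_pdivrMr//; have := hf x.
by rewrite !patchE; case: ifPn => _ //; rewrite ?mul0e// muleC.
Qed.

End nonmeasurable_integrands.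

(** * Measurability with respect to the completed measure *)

Section completed_measurability.
Context disp (T : measurableType disp) (R : realType).
Variable mu : {measure set T -> \bar R}.

Lemma null_bigcup (N : (set T)^nat) : (forall n, measurable (N n)) ->
  (forall n, mu (N n) = 0%E) -> mu (\bigcup_n N n) = 0%E.
Proof.
move=> mN N0; apply/(measure_negligible (mu := mu)).
  exact: bigcupT_measurable.
by apply: negligible_bigcup => n; exists (N n); split.
Qed.

(** The sets with this property form a sigma-algebra that contains the generators: a complement
    keeps the same null set, and a countable union takes the union of the null sets. *)
Lemma completed_measurable_off_null (A : set T) :
  (completed_algebra_gen mu).-sigma.-measurable A ->
  exists N, [/\ measurable N, mu N = 0%E & measurable (A `\` N)].
Proof.
pose G : set (set T) :=
  [set E | exists N, [/\ measurable N, mu N = 0%E & measurable (E `\` N)]].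
move: A; suff : <<s completed_algebra_gen mu >> `<=` G by [].
apply: smallest_sub; last first.
  move=> _ [B mB [N [M [mM M0 NM]] <-]]; exists M; split => //.
  rewrite setDUl [X in _ `|` X](_ : _ = set0) ?setU0; first exact: measurableD.
  by apply/seteqP; split => // x [/NM Mx /(_ Mx)].
split.
- by exists set0; split => //; rewrite setD0.
- move=> E [N [mN N0 mEN]]; exists N; split => //.
  rewrite [X in measurable X](_ : _ = ~` N `\` (E `\` N)).
    by apply: measurableD => //; exact: measurableC.
  apply/seteqP; split => x; rewrite /setD /setC /=; tauto.
- move=> F GF; pose N n := projT1 (cid (GF n)).
  have NP n : [/\ measurable (N n), mu (N n) = 0%E & measurable (F n `\` N n)].
    by rewrite /N; case: cid.
  exists (\bigcup_n N n); split.
  + by apply: bigcupT_measurable => n; case: (NP n).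
  + by apply: null_bigcup => n; case: (NP n).
  + rewrite [X in measurable X](_ : _ = (\bigcup_n (F n `\` N n)) `\` \bigcup_n N n).
      apply: measurableD; apply: bigcupT_measurable => n; by case: (NP n).
    apply/seteqP; split => x /=.
      move=> [[n _ Fx] nN]; split => //; exists n => //; split => // Nx.
      by apply: nN; exists n.
    by move=> [[n _ [Fx _]] nN]; split => //; exists n.
Qed.

(** Rational thresholds suffice: each contributes one null set, all are united into a single [N],
    and the preimage of a ray above [r] is the union of those of the rays above the rationals
    [s >= r]. *)
Lemma completed_measurable_fun_off_null (D : set T) (f : T -> R) :
  measurable D -> completed_measurable_fun mu D f ->
  exists N, [/\ measurable N, mu N = 0%E & measurable_fun (D `\` N) f].
Proof.
move=> mD mf.
have mD' : (completed_algebra_gen mu).-sigma.-measurable D.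
  apply: sub_sigma_algebra; exists D => //; exists set0; last by rewrite setU0.
  exact: negligible_set0.
(* The rationals are enumerated by [unpickle]; an [n] that codes none defaults to [0], which only
   repeats a threshold. *)
have F (n : nat) : exists N, [/\ measurable N, mu N = 0%E &
    measurable ((D `&` f @^-1` `]ratr (odflt 0 (unpickle n : option rat)), +oo[)
                `\` N)].
  apply: completed_measurable_off_null; apply: (mf mD').
  exact: measurable_itv.
pose N n := projT1 (cid (F n)).
have NP n : [/\ measurable (N n), mu (N n) = 0%E &
    measurable ((D `&` f @^-1` `]ratr (odflt 0 (unpickle n : option rat)), +oo[)
                `\` N n)].
  by rewrite /N; case: cid.
have mN : measurable (\bigcup_n N n).
  by apply: bigcupT_measurable => n; case: (NP n).
exists (\bigcup_n N n); split => //.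
  by apply: null_bigcup => n; case: (NP n).
apply: (measurability (@RGenOInfty.G R)); first exact: RGenOInfty.measurableE.
move=> /= _ [_] [r ->] <-.
pose B := [set n | r <= ratr (odflt 0 (unpickle n : option rat))].
rewrite [X in measurable X](_ : _ = (\bigcup_(n in B)
    ((D `&` f @^-1` `]ratr (odflt 0 (unpickle n : option rat)), +oo[)
                `\` N n)) `\` \bigcup_n N n).
  apply: measurableD => //; apply: bigcup_measurable => n _; by case: (NP n).
apply/seteqP; split => x /=.
  move=> [[Dx nN]]; rewrite in_itv/= andbT => rfx; split => //.
  have [s /andP[rs sf]] := rat_in_itvoo rfx.
  exists (pickle s); rewrite /B/= pickleK/=; first exact: ltW.
  by split; [rewrite in_itv/= andbT|move=> Nx; apply: nN; exists (pickle s)].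
move=> [[n /= rn [[Dx]]]]; rewrite !in_itv/= !andbT => nf _ nN; split => //.
exact: le_lt_trans nf.
Qed.

End completed_measurability.

Lemma measurable_fun_sqrt disp (T : measurableType disp) (R : realType)
    (f : T -> R) : measurable_fun [set: T] f ->
  measurable_fun [set: T] (fun x => Num.sqrt (f x)).
Proof.
move=> mf; apply: (@measurableT_comp _ _ _ _ _ _ (Num.sqrt : R -> R)) => //.
by apply: nondecreasing_measurable => // x y; exact: ler_wsqrtr.
Qed.

(** * Null sets of the line and their preimages under a distance *)

Section null_preimages.
Variable R : realType.
Implicit Types (N S A : set (measurableTypeR R)).
Local Notation leb := (@lebesgue_measure R).

(** The Lebesgue measure of [N] is an infimum over covers by half-open intervals, and [nu] of such a
    cover is at most [C] times its total length. *)
Lemma lebesgue_null_dominated (nu : {measure set (measurableTypeR R) -> \bar R})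
    (C : R) N : 0 <= C ->
  (forall a b, a <= b -> (nu `]a, b]%classic <= (C * (b - a))%:E)%E) ->
  measurable N -> leb N = 0%E -> nu N = 0%E.
Proof.
move=> C0 nuC mN N0; apply/eqP; rewrite -measure_le0.
apply/lee_addgt0Pr => e e0; rewrite add0e.
have C1 : 0 < C + 1 by rewrite ltr_wpDl.
have fN : leb N \is a fin_num by rewrite N0.
have eC : 0 < e / (C + 1) by rewrite divr_gt0.
have [_ [/= A [mA NA] <-] h] := lb_ereal_inf_adherent eC fN.
have {h} Ae : (\sum_(0 <= k <oo) wlength idfun (A k) < (e / (C + 1))%:E)%E.
  by rewrite -[ltRHS]add0e -[X in (_ < X + _)%E]N0.
have mA' n : measurable (A n : set (measurableTypeR R)).
  by apply: sub_sigma_algebra; exact: mA.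
apply: (@le_trans _ _ (\sum_(0 <= k <oo) nu (A k))%E).
  by apply: measure_sigma_subadditive => //.
apply: (@le_trans _ _ (\sum_(0 <= k <oo) C%:E * wlength idfun (A k))%E).
  apply: lee_nneseries => // n _; have [[a b] /= _ <-] := mA n.
  rewrite wlength_itv/= lte_fin; case: ltP => [ab|ba].
    by rewrite -EFinB -EFinM; apply: nuC; exact: ltW.
  by rewrite mule0 set_itv_ge ?measure0// bnd_simp -leNgt.
rewrite nneseriesZl//.
apply: (@le_trans _ _ (C%:E * (e / (C + 1))%:E)%E).
  by apply: lee_wpmul2l; rewrite ?lee_fin//; exact: ltW.
rewrite -EFinM lee_fin mulrCA -[leRHS]mulr1 ler_wpM2l ?(ltW e0)//.
by rewrite ler_pdivrMr// mul1r lerDl.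
Qed.

Lemma lebesgue_measure_le_diam A (D : R) : measurable A -> 0 <= D ->
  (forall x y, A x -> A y -> `|x - y| <= D) -> (leb A <= (D *+ 2)%:E)%E.
Proof.
move=> mA D0 AD; have [->|/set0P[x Ax]] := eqVneq A set0.
  by rewrite measure0 lee_fin mulrn_wge0.
apply: (@le_trans _ _ (leb `[x - D, x + D]%classic)).
  apply: le_measure; rewrite ?inE//.
  move=> y Ay /=; rewrite in_itv/=; have := AD _ _ Ax Ay.
  by rewrite ler_norml => /andP[h1 h2]; apply/andP; split; lra.
rewrite lebesgue_measure_itv/= lte_fin; case: ifPn => _.
  by rewrite -EFinD lee_fin; lra.
by rewrite lee_fin mulrn_wge0.
Qed.

(** On [S] the inverse of [v] is Lipschitz, so the preimage of an interval of length [l] has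
    diameter at most [C * l]. The image under [v] of Lebesgue measure on [S] is therefore dominated
    by length. *)
Lemma null_preimage_expansion (v : R -> R) (C : R) S N : 0 <= C ->
  measurable_fun [set: measurableTypeR R] (v : _ -> measurableTypeR R) ->
  measurable S ->
  (forall x y, S x -> S y -> `|x - y| <= C * `|v x - v y|) ->
  measurable N -> leb N = 0%E -> leb (v @^-1` N `&` S) = 0%E.
Proof.
move=> C0 mv mS vC mN N0.
pose v' : measurableTypeR R -> measurableTypeR R := v.
pose vm := HB.pack_for {mfun measurableTypeR R >-> measurableTypeR R} v'
  (isMeasurableFun.Build _ _ _ _ v' mv).
pose nu := pushforward (mrestr leb mS) vm.
change (nu N = 0%E).
apply: (@lebesgue_null_dominated nu (C *+ 2)) => //; first exact: mulrn_wge0.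
move=> a b ab; have ba0 : 0 <= b - a by rewrite subr_ge0.
rewrite mulrnAl; apply: lebesgue_measure_le_diam.
- apply: measurableI => //; rewrite -[X in measurable X]setTI.
  by apply: (mv measurableT); exact: measurable_itv.
- exact: mulr_ge0.
move=> x y [/= vx Sx] [vy Sy]; rewrite (le_trans (vC _ _ Sx Sy))//.
rewrite ler_wpM2l// ler_norml; move: vx vy; rewrite /= !in_itv/=.
rewrite /v' => /andP[? ?] /andP[? ?]; apply/andP; split; lra.
Qed.

(** The only critical point is [u = c]. The sets [S s n], with [s] the sign of [c - u] and [|c - u|]
    between [1 / (n + 1)] and [n + 1], cover the rest of the line, and on each of them the map has a
    Lipschitz inverse. *)
Lemma null_preimage_hypot (c w : R) N : 0 <= w -> measurable N -> leb N = 0%E ->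
  leb [set u | N (Num.sqrt ((c - u) ^+ 2 + w))] = 0%E.
Proof.
move=> w0 mN N0; pose v (u : measurableTypeR R) : measurableTypeR R :=
    Num.sqrt ((c - u) ^+ 2 + w).
have mv : measurable_fun setT v.
  apply: measurable_fun_sqrt; apply: measurable_funD => //; apply: measurable_funX.
  exact: measurable_funB.
have vsq u : v u ^+ 2 = (c - u) ^+ 2 + w by rewrite sqr_sqrtr// addr_ge0 ?sqr_ge0.
pose S (s : R) n := [set u : measurableTypeR R | n.+1%:R^-1 <= s * (c - u) <= n.+1%:R].
have mS s n : measurable (S s n).
  rewrite /S -[X in measurable X]setTI.
  have -> : [set u | n.+1%:R^-1 <= s * (c - u) <= n.+1%:R] =
     (fun u : measurableTypeR R => s * (c - u)) @^-1` `[n.+1%:R^-1, n.+1%:R]%classic.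
    by apply/seteqP; split => u /=; rewrite in_itv.
  have mf : measurable_fun [set: measurableTypeR R]
      (fun u => s * (c - u) : measurableTypeR R).
    by apply: measurable_funM => //; exact: measurable_funB.
  by apply: (mf measurableT); exact: measurable_itv.
have key s n : s ^+ 2 = 1 -> leb (v @^-1` N `&` S s n) = 0%E.
  move=> s1; pose M : R := Num.sqrt (n.+1%:R ^+ 2 + w).
  have M0 : 0 <= M by exact: sqrtr_ge0.
  have n0 : (0 : R) < n.+1%:R by [].
  apply: (@null_preimage_expansion _ (M * n.+1%:R)) => //.
    by rewrite mulr_ge0.
  have vM x : S s n x -> v x <= M.
    move=> /andP[h1 h2]; rewrite /v /M ler_wsqrtr// lerD2r.
    have -> : (c - x) ^+ 2 = (s * (c - x)) ^+ 2 by rewrite exprMn s1 mul1r.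
    by rewrite ler_sqr ?nnegrE// ?(le_trans _ h1)// invr_ge0.
  move=> x y Sx Sy; have vx := vM _ Sx; have vy := vM _ Sy.
  (* Difference of squares: on [S s n] the second factor on the left has absolute value at least
     [2 / (n + 1)], and [v y + v x] is at most [2 * M]. *)
  have E : (x - y) * (s * (s * (c - x) + s * (c - y))) =
      (v y - v x) * (v y + v x).
    transitivity (s ^+ 2 * ((x - y) * ((c - x) + (c - y)))); first by ring.
    by rewrite -subr_sqr !vsq s1; ring.
  have s1' : `|s| = 1.
    by apply/eqP; rewrite -(@eqrXn2 _ 2)// -normrX s1 normr1 expr1n.
  have a0 : 2 * n.+1%:R^-1 <= s * (c - x) + s * (c - y).
    case/andP: Sx => hx _; case/andP: Sy => hy _.
    by rewrite mulr_natl mulr2n lerD.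
  have i0 : 0 < n.+1%:R^-1 :> R by rewrite invr_gt0.
  have := congr1 Num.norm E; rewrite !normrM s1' mul1r.
  rewrite (ger0_norm (_ : 0 <= s * (c - x) + s * (c - y))); last first.
    by rewrite (le_trans _ a0)// mulr_ge0// ltW.
  rewrite (ger0_norm (_ : 0 <= v y + v x)); last first.
    by rewrite addr_ge0// sqrtr_ge0.
  rewrite (distrC (v y)) => {}E.
  have : `|x - y| * (2 * n.+1%:R^-1) <= `|v x - v y| * (2 * M).
    rewrite (le_trans (ler_wpM2l (normr_ge0 _) a0))// E ler_wpM2l//; lra.
  rewrite mulrA ler_pdivrMr// => h.
  by rewrite -(@ler_pM2r _ 2)//; move: h; nra.
pose E := \bigcup_n (v @^-1` N `&` S 1 n) `|` \bigcup_n (v @^-1` N `&` S (-1) n).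
have mvN : measurable (v @^-1` N : set (measurableTypeR R)).
  by rewrite -[X in measurable X]setTI; exact: mv.
have mE s : measurable (\bigcup_n (v @^-1` N `&` S s n)).
  by apply: bigcupT_measurable => n; exact: measurableI.
have E0 s : s ^+ 2 = 1 -> leb (\bigcup_n (v @^-1` N `&` S s n)) = 0%E.
  move=> s1; apply: null_bigcup => n; first by apply: measurableI.
  exact: key.
have cover u : u != c -> exists n, exists2 s, s = 1 \/ s = -1 & S s n u.
  move=> uc; have h : 0 < `|c - u| by rewrite normr_gt0 subr_eq0 eq_sym.
  pose n := maxn (Num.truncn `|c - u|) (Num.truncn `|c - u|^-1).
  exists n; exists (Num.sg (c - u)).
    by case: sgrP h; rewrite ?normr0 ?ltxx//; [left|right].
  rewrite /S/= -normrEsg; apply/andP; split.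
    rewrite -[leRHS]invrK lef_pV2 ?posrE ?invr_gt0//.
    rewrite ltW// (lt_le_trans (truncnS_gt _))// ler_nat ltnS.
    exact: leq_maxr.
  by rewrite ltW// (lt_le_trans (truncnS_gt _))// ler_nat ltnS leq_maxl.
apply: (@measure_negligible _ _ _ leb) => //.
apply: (@negligibleS _ _ _ leb (E `|` [set c])).
  move=> u /= Nu; have [->|/cover[n [s [->|->] Su]]] := eqVneq u c.
  - by right.
  - by left; left; exists n.
  - by left; right; exists n.
apply: negligibleU; last by exists [set c]; split => //; exact: lebesgue_measure_set1.
apply: negligibleU.
  by exists (\bigcup_n (v @^-1` N `&` S 1 n)); split => //; apply: E0; rewrite expr1n.
by exists (\bigcup_n (v @^-1` N `&` S (-1) n)); split => //; apply: E0; rewrite sqrrN expr1n.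
Qed.

End null_preimages.

(** * Euclidean distance and the volume of balls *)

Section euclidean_distance.
Variables (R : realType) (d : nat).
Implicit Types (x y z : Rd R d) (r t : R).
Local Notation mu := (lebesgueRd R d).

Lemma edist_ge0 x y : 0 <= edist x y.
Proof. exact: sqrtr_ge0. Qed.

Lemma edistC x y : edist x y = edist y x.
Proof. by congr Num.sqrt; apply: eq_bigr => i _; rewrite -sqrrN opprB. Qed.

Lemma edist_sqr x y : edist x y ^+ 2 = \sum_(i < d) (tnth x i - tnth y i) ^+ 2.
Proof. by rewrite sqr_sqrtr// sumr_ge0// => i _; exact: sqr_ge0. Qed.

(* A quasi-triangle inequality, from [(a + b)^2 <= 2 a^2 + 2 b^2]; the sharp one
   is not needed. *)
Lemma edist_lt_max x y z t : edist x y < t -> edist y z < t ->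
  edist x z < t *+ 2.
Proof.
move=> xy yz; have t0 : 0 < t by rewrite (le_lt_trans _ xy)// edist_ge0.
rewrite -ltr_sqr ?nnegrE ?edist_ge0 ?mulrn_wge0 ?(ltW t0)//.
apply: (@le_lt_trans _ _ ((edist x y ^+ 2) *+ 2 + (edist y z ^+ 2) *+ 2)).
  rewrite !edist_sqr -!sumrMnl -big_split/=; apply: ler_sum => i _.
  rewrite -subr_ge0; set a := tnth x i; set b := tnth y i; set c := tnth z i.
  have -> : (a - b) ^+ 2 *+ 2 + (b - c) ^+ 2 *+ 2 - (a - c) ^+ 2 =
    (a - b - (b - c)) ^+ 2 by ring.
  exact: sqr_ge0.
move: xy yz; rewrite -(@ltr_sqr _ (edist x y)) ?nnegrE ?edist_ge0 ?(ltW t0)//.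
rewrite -(@ltr_sqr _ (edist y z)) ?nnegrE ?edist_ge0 ?(ltW t0)//.
by move=> h1 h2; rewrite exprMn_n; lra.
Qed.

Lemma measurable_fun_edist disp (T : measurableType disp) (f g : T -> Rd R d) :
  measurable_fun setT f -> measurable_fun setT g ->
  measurable_fun setT (fun a => edist (f a) (g a)).
Proof.
move=> mf mg; apply: measurable_fun_sqrt; apply: measurable_sum => i.
apply: measurable_funX; apply: measurable_funB.
  apply: (@measurableT_comp _ _ _ _ _ _ ((@tnth _ (measurableTypeR R))^~ i)) => //.
  exact: measurable_tnth.
apply: (@measurableT_comp _ _ _ _ _ _ ((@tnth _ (measurableTypeR R))^~ i)) => //.
exact: measurable_tnth.
Qed.

Lemma measurable_eball x r : measurable (eball x r).
Proof.
rewrite -[X in measurable X]setTI.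
have h : measurable_fun setT (fun y : Rd R d => edist y x).
  exact: measurable_fun_edist.
have -> : eball x r = (fun y => edist y x) @^-1` `]-oo, r[%classic.
  by apply/seteqP; split => y; rewrite /eball /= in_itv.
by apply: (h measurableT); exact: measurable_itv.
Qed.

Lemma eball_measure_le x r : 0 < r -> (mu (eball x r) <= ((r *+ 2) ^+ d)%:E)%E.
Proof.
move=> r0.
pose A (i : 'I_d) : set (measurableTypeR R) := `]tnth x i - r, tnth x i + r[%classic.
have mA i : measurable (A i) by exact: measurable_itv.
have AE i : lebesgue_measure (A i) = (r *+ 2)%:E.
  rewrite /A lebesgue_measure_itv/= lte_fin ifT; last by lra.
  by rewrite -EFinD; congr EFin; ring.
have mbox : measurable [set y : Rd R d | forall i, A i (tnth y i)].
  rewrite (_ : [set _ | _] = \bigcap_(i in [set: 'I_d])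
      ((@tnth _ (measurableTypeR R))^~ i @^-1` A i)); last first.
    by apply/seteqP; split => y /= h i //=; exact: h.
  apply: fin_bigcap_measurable => // i _.
  by rewrite -[X in measurable X]setTI; exact: measurable_tnth.
have -> : ((r *+ 2) ^+ d)%:E = mu [set y | forall i, A i (tnth y i)].
  rewrite lebesgueRd_box//; under eq_bigr do rewrite AE.
  by rewrite prodEFin prodr_const card_ord.
apply: le_measure; rewrite ?inE//; first exact: measurable_eball.
move=> y xy i; rewrite /A /= in_itv/=.
have : `|tnth y i - tnth x i| < r.
  apply: le_lt_trans xy.
  rewrite -(@ler_sqr _ _ (edist y x)) ?nnegrE ?edist_ge0// edist_sqr.
  rewrite real_normK ?num_real// (bigD1 i)//= lerDl sumr_ge0// => j _.
  exact: sqr_ge0.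
by rewrite ltr_norml => /andP[h1 h2]; apply/andP; split; lra.
Qed.

Lemma eball_measure_ge x r : 0 < r ->
  (((r / d.+1%:R) ^+ d)%:E <= mu (eball x r))%E.
Proof.
move=> r0; pose e := r / d.+1%:R.
have e0 : 0 < e by rewrite divr_gt0.
pose A (i : 'I_d) : set (measurableTypeR R) := `]tnth x i, tnth x i + e[%classic.
have mA i : measurable (A i) by exact: measurable_itv.
have AE i : lebesgue_measure (A i) = e%:E.
  rewrite /A lebesgue_measure_itv/= lte_fin ifT; last by lra.
  by rewrite -EFinD; congr EFin; ring.
have mbox : measurable [set y : Rd R d | forall i, A i (tnth y i)].
  rewrite (_ : [set _ | _] = \bigcap_(i in [set: 'I_d])
      ((@tnth _ (measurableTypeR R))^~ i @^-1` A i)); last first.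
    by apply/seteqP; split => y /= h i //=; exact: h.
  apply: fin_bigcap_measurable => // i _.
  by rewrite -[X in measurable X]setTI; exact: measurable_tnth.
have -> : (e ^+ d)%:E = mu [set y | forall i, A i (tnth y i)].
  rewrite lebesgueRd_box//; under eq_bigr do rewrite AE.
  by rewrite prodEFin prodr_const card_ord.
apply: le_measure; rewrite ?inE//; first exact: measurable_eball.
move=> y Ay; rewrite /eball/=.
rewrite -ltr_sqr ?nnegrE ?edist_ge0 ?(ltW r0)// edist_sqr.
apply: (@le_lt_trans _ _ (\sum_(i < d) e ^+ 2)).
  apply: ler_sum => i _; have := Ay i; rewrite /A/= in_itv/= => /andP[h1 h2].
  rewrite ler_sqr ?nnegrE; lra.
rewrite sumr_const card_ord.
have re : r = e *+ d.+1 by rewrite /e -mulr_natr divfK.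
rewrite re exprMn_n ltr_pMn2l ?exprn_gt0//.
by rewrite -mulnn leq_pmulr.
Qed.

End euclidean_distance.

Section null_distance_sets.
Variables (R : realType) (d : nat).

Lemma edist_cons (a b : measurableTypeR R) (x y : Rd R d) :
  edist (cons_point (a, x)) (cons_point (b, y)) =
  Num.sqrt ((a - b) ^+ 2 + edist x y ^+ 2).
Proof.
rewrite edist_sqr /edist big_ord_recl; congr Num.sqrt; congr (_ + _).
by apply: eq_bigr => i _; rewrite !tnthS.
Qed.

(* Tonelli over the first coordinate: each slice is a null preimage under
   [u |-> sqrt ((c - u)^2 + w)]. *)
Lemma null_preimage_edist (x : Rd R d.+1) (N : set (measurableTypeR R)) :
  measurable N -> lebesgue_measure N = 0%E ->
  lebesgueRd R d.+1 [set y | N (edist x y)] = 0%E.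
Proof.
move=> mN N0; rewrite /= /lebesgue_step /pushforward.
set E := _ @^-1` _.
have mE : measurable E.
  rewrite /E -[X in measurable X]setTI; apply: measurable_cons_point => //.
  rewrite -[X in measurable X]setTI.
  have h : measurable_fun setT (fun y : Rd R d.+1 => edist x y : measurableTypeR R).
    exact: measurable_fun_edist.
  exact: (h measurableT).
rewrite -(setIT E) -integral_indic// fubini_tonelli2//=; last first.
  exact/measurable_EFinP/measurable_indicP.
apply: integral0_eq => y _; rewrite /fubini_G/=.
rewrite -[RHS](null_preimage_hypot (thead x) (sqr_ge0 (edist (behead_tuple x) y))
  mN N0).
rewrite integral_indic//= ?setIT.
  congr lebesgue_measure; apply/funext => u; rewrite /E /=.
  by rewrite {1}(tuple_eta x) -edist_cons.
rewrite (_ : (fun _ => _) = ysection E y); first exact: measurable_ysection.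
by apply/seteqP; split => u; rewrite /ysection/= inE.
Qed.

End null_distance_sets.

(** * Powers, indicators and almost decreasing functions *)

Section real_functions.
Variable R : realType.

Lemma measurable_fun_nat_of_bool disp (T : measurableType disp) (b : T -> bool) :
  measurable_fun [set: T] b -> measurable_fun [set: T] (fun x => (b x)%:R : R).
Proof.
move=> mb; rewrite (_ : (fun _ => _) = fun x => if b x then 1 else 0 : R).
  exact: measurable_fun_ifT.
by apply/funext => x; case: (b x).
Qed.

Lemma measurable_fun_powR_cst disp (T : measurableType disp) (f : T -> R) (c : R) :
  measurable_fun [set: T] f -> measurable_fun [set: T] (fun x => f x `^ c).
Proof.
move=> mf; apply: (@measurableT_comp _ _ _ _ _ _ (fun x : R => x `^ c))=> //.
Qed.

(* The minorant is [inf_(0 < s <= t) g s], written as a monotone function of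
   [ln t] so as to be monotone on the whole line. *)
Lemma almost_decreasing_measurable (g : R -> R) :
  (forall t, 0 < t -> 0 < g t) -> almost_decreasing g ->
  exists g0 : R -> R, [/\ measurable_fun setT g0, (forall t, 0 <= g0 t) &
    exists2 C, 0 < C & forall t, 0 < t -> g0 t <= g t <= C * g0 t].
Proof.
move=> g_gt0 [C C0 gC].
pose A (u : R) := [set g s | s in [set s | 0 < s <= expR u]].
have A0 u : lbound (A u) 0 by move=> _ [s /= /andP[s0 _] <-]; exact/ltW/g_gt0.
have Ai u : has_inf (A u).
  split; last by exists 0; exact: A0.
  by exists (g (expR u)), (expR u) => //=; rewrite expR_gt0 lexx.
exists (fun t => inf (A (ln t))); split.
- apply: (@measurableT_comp _ _ _ _ _ _ (fun u => inf (A u))) => //.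
  apply: nonincreasing_measurable => // u v uv.
  apply: lb_le_inf; first by case: (Ai u).
  move=> _ [s /= /andP[s0 su] <-]; apply: ge_inf; first by case: (Ai v).
  by exists s => //=; rewrite s0/= (le_trans su)// ler_expR.
- by move=> t; apply: lb_le_inf; [case: (Ai (ln t))|exact: A0].
exists C => // t t0; apply/andP; split.
  apply: ge_inf; first by case: (Ai (ln t)).
  by exists t => //=; rewrite t0 lnK ?posrE ?lexx.
rewrite -ler_pdivrMl//; apply: lb_le_inf; first by case: (Ai (ln t)).
move=> _ [s /= /andP[s0 st] <-]; rewrite ler_pdivrMl//.
by apply: gC => //; rewrite lnK ?posrE// in st.
Qed.

End real_functions.

(** * The kernel as an average over balls *)

Section kernel.
Variables (R : realType) (d : nat) (rho : R -> R).
Hypotheses (mrho : measurable_fun setT rho) (rho_ge0 : forall t, 0 <= rho t).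
Local Notation mu := (lebesgueRd R d).
Local Notation leb := (@lebesgue_measure R).
Local Notation k := (@frac_kernel R d rho).
Implicit Types (x y z : Rd R d) (h : Rd R d -> R).

Lemma kernelE x y : k x y = rho (edist x y) * edist x y `^ (- d%:R).
Proof. by rewrite /frac_kernel powR_invn// edist_ge0. Qed.

Lemma kernel_ge0 x y : 0 <= k x y.
Proof. by rewrite /frac_kernel mulr_ge0// invr_ge0 exprn_ge0// edist_ge0. Qed.

Lemma kernelC x y : k x y = k y x.
Proof. by rewrite /frac_kernel edistC. Qed.

Lemma measurable_fun_kernel disp (T : measurableType disp) (f g : T -> Rd R d) :
  measurable_fun setT f -> measurable_fun setT g ->
  measurable_fun setT (fun a => k (f a) (g a)).
Proof.
move=> mf mg; under eq_fun do rewrite kernelE.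
have me := measurable_fun_edist mf mg.
apply: measurable_funM; last exact: measurable_fun_powR_cst.
exact: (@measurableT_comp _ _ _ _ _ _ rho).
Qed.

Variables (N : set (measurableTypeR R)) (C : R).
Hypotheses (mN : measurable N) (N0 : leb N = 0%E) (C0 : 0 < C).
(** Only [t] is kept off [N]: this is what remains of doubling once [rho] has been set to [0] on a
    null set. *)
Hypothesis rhoC : forall u t, 0 < u -> 0 < t -> ~ N t ->
  2^-1 <= u / t <= 2 -> rho u <= C * rho t.

(* The kernel is an average of balls: doubling lets [rho u / u^d] be recovered
   from the values of [rho] on [(c u, 2 c u)]. *)
Lemma kernel_le_average (c u : R) : 2^-1 <= c <= 1 -> 0 < u ->
  ((rho u * u `^ (- d%:R))%:E <= (C * 2 ^+ d.+2)%:E *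
   \int[leb]_t (rho t * t `^ (- d.+1%:R) *
                ((c * u < t) && (t < 2 * c * u))%:R)%:E)%E.
Proof.
move=> /andP[c2 c1] u0.
have c0 : 0 < c by lra.
(* A lower bound for [rho t * t^(-(d+1))] at the [t] in [(c u, 2 c u)] off [N], where [u / t] lies
   in [[1/2, 2]] and [t <= 2 u]. The interval has length [c u >= u / 2], whence the constant
   [C * 2^(d+2)]. *)
pose b := rho u / C * (2 * u) `^ (- d.+1%:R).
have b0 : 0 <= b by rewrite mulr_ge0 ?powR_ge0// divr_ge0// ltW.
pose I := `]c * u, 2 * c * u[%classic : set (measurableTypeR R).
apply: (@le_trans _ _ ((C * 2 ^+ d.+2)%:E * \int[leb]_(t in I) b%:E)%E).
  rewrite integral_cst; last exact: measurable_itv.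
  rewrite /= lebesgue_measure_itv/= lte_fin ifT; last by nra.
  rewrite -EFinD -!EFinM lee_fin /b !powR_invn; [|lra..].
  rewrite exprMn invfM.
  have -> : C * 2 ^+ d.+2 *
      (rho u / C * (2 ^- d.+1 * u ^- d.+1) * (2 * c * u - c * u)) =
    (2 * c) * (rho u * u ^- d).
    rewrite (exprS 2 d.+1) (exprS u d); field.
    by rewrite !expf_neq0 ?gt_eqF.
  rewrite -[leLHS]mul1r ler_wpM2r//; last by lra.
  by rewrite mulr_ge0// invr_ge0 exprn_ge0// ltW.
apply: lee_wpmul2l; first by rewrite lee_fin mulr_ge0// ltW.
rewrite integral_mkcond; apply: (@le_integral_off_null _ _ _ _ _ N) => //.
- by move=> t _; apply: erestrict_ge0 => ? _; rewrite lee_fin.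
- by move=> t _; rewrite lee_fin !mulr_ge0// powR_ge0.
move=> t _ nNt; rewrite patchE.
case: ifPn; last by move=> _; rewrite lee_fin !mulr_ge0// powR_ge0.
rewrite inE /I /= in_itv/= => /andP[ct tc].
rewrite ct tc mulr1 lee_fin /b.
have t0 : 0 < t by nra.
apply: ler_pM; rewrite ?powR_ge0 ?divr_ge0 ?(ltW C0)//.
  rewrite ler_pdivrMr// mulrC; apply: rhoC => //; apply/andP; split.
    by rewrite ler_pdivlMr//; nra.
  by rewrite ler_pdivrMr//; nra.
rewrite !powRN lef_pV2 ?posrE ?powR_gt0//; last by lra.
by apply: ge0_ler_powR; rewrite ?nnegrE ?ler0n ?(ltW t0)//; nra.
Qed.

(** By Tonelli: the kernel at distance [u] is bounded by an average over [t] in [(c u, 2 c u)], and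
    for fixed [t] the points [z] involved lie in [eball x (2 * t)] since [c >= 1/2]. The product of
    [t^(-(d+1))] and [t^d] leaves the [1 / t] of the conditions on [rho]. [J] selects distances and
    [I] contains the radii they reach. *)
Lemma kernel_integral_le (c : R) (J I : R -> bool) (w : R -> R) x h :
  2^-1 <= c <= 1 -> (0 < d)%N ->
  measurable_fun setT J -> measurable_fun setT (I : measurableTypeR R -> bool) ->
  measurable_fun setT w ->
  measurable_fun setT h -> (forall z, 0 <= h z) ->
  (forall u t, 0 < u -> J u -> c * u < t < 2 * c * u -> I t) ->
  (forall t, I t -> 0 < t) ->
  (forall t, I t -> (\int[mu]_(z in eball x (2 * t)) (h z)%:E <= (t ^+ d * w t)%:E)%E) ->
  (\int[mu]_z (k x z * h z * (J (edist x z))%:R)%:E <= (C * 2 ^+ d.+2)%:E *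
   \int[leb]_t ((I t)%:R * (rho t * w t / t))%:E)%E.
Proof.
move=> c12 d0 mJ mI mw mh h0 JI I0 hw; have /andP[c2 c1] := c12.
pose F (z : Rd R d * measurableTypeR R) : R := (I z.2)%:R *
  (rho z.2 * z.2 `^ (- d.+1%:R)) *
  (h z.1 * ((c * edist x z.1 < z.2) && (z.2 < 2 * c * edist x z.1))%:R).
have F0 a : 0 <= F a by rewrite !mulr_ge0// powR_ge0.
have mF : measurable_fun setT F.
  have mc : measurable_fun setT (fun a : Rd R d * measurableTypeR R => edist x a.1).
    exact: measurable_fun_edist.
  apply: measurable_funM; last apply: measurable_funM.
  - apply: measurable_funM.
      by apply: measurable_fun_nat_of_bool; exact: measurableT_comp.
    apply: measurable_funM; first exact: measurableT_comp.
    by apply: measurable_fun_powR_cst.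
  - exact: measurableT_comp.
  apply: measurable_fun_nat_of_bool; apply: measurable_and.
    by apply: measurable_fun_ltr => //; exact: measurable_funM.
  by apply: measurable_fun_ltr => //; exact: measurable_funM.
apply: (@le_trans _ _ (\int[mu]_z ((C * 2 ^+ d.+2)%:E * \int[leb]_t (F (z, t))%:E))%E).
  apply: le_integral_nonneg.
    by move=> z _; rewrite lee_fin mulr_ge0// mulr_ge0// kernel_ge0.
  (* At distance [0] the kernel vanishes: a power of [0] with nonzero exponent is [0], and
     [d > 0]. *)
  move=> z _; have := edist_ge0 x z; rewrite le_eqVlt => /predU1P[e0|e0].
    rewrite kernelE -e0 powR0 ?mulr0 ?mul0r.
      by apply: mule_ge0; [rewrite lee_fin mulr_ge0// ltW|apply: integral_ge0 => t _; rewrite lee_fin].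
    by rewrite oppr_eq0 pnatr_eq0 -lt0n.
  have [Jz|] := boolP (J (edist x z)); last first.
    rewrite mulr0 => _.
    by apply: mule_ge0; [rewrite lee_fin mulr_ge0// ltW|apply: integral_ge0 => t _; rewrite lee_fin].
  rewrite mulr1 kernelE mulrC EFinM.
  apply: (@le_trans _ _ ((h z)%:E * ((C * 2 ^+ d.+2)%:E *
   \int[leb]_t (rho t * t `^ (- d.+1%:R) *
                ((c * edist x z < t) && (t < 2 * c * edist x z))%:R)%:E))%E).
    apply: lee_wpmul2l; first by rewrite lee_fin.
    exact: kernel_le_average.
  rewrite muleCA; apply: lee_wpmul2l; first by rewrite lee_fin mulr_ge0// ltW.
  rewrite -ge0_integralZl_EFin//; last 2 first.
  - by move=> t _; rewrite lee_fin !mulr_ge0// powR_ge0.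
  - apply/measurable_EFinP; apply: measurable_funM.
      by apply: measurable_funM => //; exact: measurable_fun_powR_cst.
    apply: measurable_fun_nat_of_bool; apply: measurable_and;
      exact: measurable_fun_ltr.
  apply: le_integral_nonneg.
    by move=> t _; rewrite -EFinM lee_fin !mulr_ge0// powR_ge0.
  move=> t _; rewrite -EFinM lee_fin /F/=.
  have [ut|_] := boolP (_ < t < _); last by rewrite !mulr0.
  by rewrite (JI _ _ e0 Jz ut) mul1r !mulr1 mulrC.
rewrite ge0_integralZl_EFin//; last 3 first.
- by move=> z _; apply: integral_ge0 => t _; rewrite lee_fin.
- apply: (@measurable_fun_fubini_tonelli_F _ _ _ _ _ leb (EFin \o F)) => //.
  exact/measurable_EFinP.
- by rewrite mulr_ge0// ltW.
apply: lee_wpmul2l; first by rewrite lee_fin mulr_ge0// ltW.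
rewrite (@fubini_tonelli _ _ _ _ _ mu leb (EFin \o F))//; last first.
  exact/measurable_EFinP.
apply: le_integral_nonneg.
  by move=> t _; apply: integral_ge0 => z _; rewrite lee_fin.
move=> t _; rewrite /= /F/=.
have [It|_] := boolP (I t); last first.
  by rewrite integral0_eq => [|z _]; rewrite /= !mul0r.
have t0 := I0 _ It.
under eq_integral do rewrite mul1r EFinM.
rewrite ge0_integralZl_EFin//; last 3 first.
- by move=> z _; rewrite lee_fin mulr_ge0.
- apply/measurable_EFinP; apply: measurable_funM => //.
  have mc : measurable_fun setT (fun z : Rd R d => edist x z).
    exact: measurable_fun_edist.
  apply: measurable_fun_nat_of_bool; apply: measurable_and;
    by apply: measurable_fun_ltr => //; exact: measurable_funM.
- by rewrite mulr_ge0// powR_ge0.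
rewrite mul1r (_ : (rho t * w t / t)%:E = (rho t * t `^ (- d.+1%:R))%:E * (t ^+ d * w t)%:E)%E; last first.
  rewrite -EFinM powR_invn ?(ltW t0)// exprS; congr EFin; field.
  by rewrite expf_neq0 gt_eqF.
apply: lee_wpmul2l; first by rewrite lee_fin mulr_ge0// powR_ge0.
apply: le_trans (hw _ It).
rewrite [leRHS]integral_mkcond; apply: le_integral_nonneg.
  by move=> z _; rewrite lee_fin mulr_ge0.
move=> z _; rewrite patchE; case: ifPn => [_|].
  by rewrite lee_fin ler_piMr// lern1 leq_b1.
rewrite notin_setE /eball /= edistC => /negP; rewrite -leNgt => tz.
rewrite (_ : _ && _ = false) ?mulr0//; apply/negbTE; rewrite negb_and -leNgt.
by apply/orP; left; nra.
Qed.

End kernel.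

(** * Near and far parts of a potential *)

Section near_and_far_parts.
Variables (R : realType) (d : nat).
Local Notation mu := (lebesgueRd R d).
Local Notation leb := (@lebesgue_measure R).
Implicit Types (x y z : Rd R d) (h : Rd R d -> R) (k : Rd R d -> Rd R d -> R).

(** Together with [far_bound], this is all that later estimates know about the size of the kernel:
    averages of [h] at most [m], respectively [m * phi t], control the part of the potential inside,
    respectively outside, the ball of radius [s]. The exponents are those of the integral conditions
    on [rho], with [e = q / qb]. *)
Definition near_bound k (phi : R -> R) (e K : R) := forall x h (m s : R),
  measurable_fun setT h -> (forall z, 0 <= h z) -> 0 <= m -> 0 < s ->
  (forall t, 0 < t ->
    (\int[mu]_(z in eball x (2 * t)) (h z)%:E <= (t ^+ d * m)%:E)%E) ->
  (\int[mu]_z (k x z * h z * (edist x z < s)%R%:R)%:E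
     <= (K * m * phi s `^ (e - 1))%:E)%E.

Definition far_bound k (phi : R -> R) (e K : R) := forall x h (m s : R),
  measurable_fun setT h -> (forall z, 0 <= h z) -> 0 <= m -> 0 < s ->
  (forall t, 0 < t ->
    (\int[mu]_(z in eball x (2 * t)) (h z)%:E <= (t ^+ d * (m * phi t))%:E)%E) ->
  (\int[mu]_z (k x z * h z * (s <= edist x z)%R%:R)%:E
     <= (K * m * phi s `^ e)%:E)%E.

Variables (rho phi phi0 : R -> R) (e : R) (N : set (measurableTypeR R)) (C B D : R).
Hypotheses (d0 : (0 < d)%N).
Hypotheses (mrho : measurable_fun setT rho) (rho_ge0 : forall t, 0 <= rho t).
Hypotheses (mN : measurable N) (N0 : leb N = 0%E) (C0 : 0 < C).
Hypothesis rhoC : forall u t, 0 < u -> 0 < t -> ~ N t ->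
  2^-1 <= u / t <= 2 -> rho u <= C * rho t.
Local Notation k := (@frac_kernel R d rho).

(** The choice [c = 1/2] averages over [t] in [(u/2, u)], which stays below [s] when the distance
    [u] does. *)
Lemma frac_kernel_near_bound :
  (forall s, 0 < s -> (\int[leb]_(t in `]0%R, s[) (rho t / t)%:E
     <= (B * phi s `^ (e - 1))%:E)%E) ->
  near_bound k phi e (C * 2 ^+ d.+2 * B).
Proof.
move=> HB x h m s mh h0 m0 s0 hm.
apply: (le_trans (@kernel_integral_le _ _ _ mrho rho_ge0 _ _ mN N0 C0 rhoC
  2^-1 (fun u => u < s) (fun t => 0 < t < s) (cst m) x h _ _ _ _ _ _ _ _ _ _)) => //.
- by apply/andP; split; lra.
- exact: measurable_fun_ltr.
- by apply: measurable_and; exact: measurable_fun_ltr.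
- by move=> u t u0 us /andP[? ?]; apply/andP; split; nra.
- by move=> t /andP[].
- by move=> t /andP[t0 _]; exact: hm.
rewrite -mulrA -mulrA [leRHS]EFinM.
apply: lee_wpmul2l; first by rewrite lee_fin mulr_ge0// ltW.
apply: (@le_trans _ _ (m%:E * \int[leb]_t ((0 < t < s)%R%:R * (rho t * t `^ (-1)))%:E)%E).
  rewrite -ge0_integralZl_EFin//.
  - apply: le_integral_nonneg => t _.
      have [/andP[t0 _]|_] := boolP (0 < t < s); last by rewrite /= mul0r.
      by rewrite lee_fin mul1r !mulr_ge0// invr_ge0 ltW.
    have [/andP[t0 _]|_] := boolP (0 < t < s); last by rewrite /= !mul0r mule0.
    by rewrite -EFinM lee_fin !mul1r powR_inv1 ?(ltW t0)//= mulrA (mulrC m).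
  - by move=> t _; rewrite lee_fin !mulr_ge0// powR_ge0.
  apply/measurable_EFinP; apply: measurable_funM.
    apply: measurable_fun_nat_of_bool; apply: measurable_and;
      exact: measurable_fun_ltr.
  by apply: measurable_funM => //; exact: measurable_fun_powR_cst.
rewrite mulrCA [leRHS]EFinM; apply: lee_wpmul2l; first by rewrite lee_fin.
apply: le_trans (HB _ s0); rewrite [leRHS]integral_mkcond.
apply: le_integral_nonneg => t _.
  by rewrite lee_fin !mulr_ge0// powR_ge0.
rewrite patchE mem_setE in_itv/=.
have [/andP[t0 _]|_] := boolP (0 < t < s); last by rewrite /= !mul0r.
by rewrite mul1r powR_inv1 ?(ltW t0).
Qed.

(** The choice [c = 1] averages over [t] in [(u, 2 u)], which stays beyond [s] when [u >= s]. The
    bound used in [kernel_integral_le] has to be measurable in [t], so [m * phi t] is weakened to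
    [m * D * phi0 t]. *)
Lemma frac_kernel_far_bound : measurable_fun setT phi0 ->
  (forall t, 0 <= phi0 t) -> 0 <= D -> (forall t, 0 < t -> phi t <= D * phi0 t) ->
  (forall s, 0 < s -> (\int[leb]_(t in `]s, +oo[) (rho t * phi0 t / t)%:E
     <= (B * phi s `^ e)%:E)%E) ->
  far_bound k phi e (C * 2 ^+ d.+2 * D * B).
Proof.
move=> mphi0 phi0_ge0 D0 phiD HB x h m s mh h0 m0 s0 hm.
apply: (le_trans (@kernel_integral_le _ _ _ mrho rho_ge0 _ _ mN N0 C0 rhoC
  1 (fun u => s <= u) (fun t => s < t) (fun t => (m * D) * phi0 t) x h _ _ _ _ _ _ _ _ _ _)) => //.
- by apply/andP; split; lra.
- exact: measurable_fun_ler.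
- exact: measurable_fun_ltr.
- exact: measurable_funM.
- by move=> u t u0 us /andP[? ?]; lra.
- by move=> t; exact: lt_trans.
- move=> t st; have t0 := lt_trans s0 st; apply: (le_trans (hm _ t0)).
  rewrite lee_fin ler_wpM2l ?exprn_ge0 ?(ltW t0)// -mulrA ler_wpM2l//.
  exact: phiD.
have -> : C * 2 ^+ d.+2 * D * B * m * phi s `^ e =
  (C * 2 ^+ d.+2) * ((m * D) * (B * phi s `^ e)) by ring.
rewrite [leRHS]EFinM; apply: lee_wpmul2l; first by rewrite lee_fin mulr_ge0// ltW.
apply: (@le_trans _ _ ((m * D)%:E * \int[leb]_t ((s < t)%R%:R * (rho t * phi0 t * t `^ (-1)))%:E)%E).
  rewrite -ge0_integralZl_EFin//.
  - apply: le_integral_nonneg => t _.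
      have [/(lt_trans s0) t0|_] := boolP (s < t); last by rewrite /= mul0r.
      by rewrite lee_fin mul1r !mulr_ge0// invr_ge0 ltW.
    have [/(lt_trans s0) t0|_] := boolP (s < t); last by rewrite /= !mul0r mule0.
    rewrite -EFinM lee_fin !mul1r powR_inv1 ?(ltW t0)//=.
    rewrite le_eqVlt; apply/orP; left; apply/eqP; ring.
  - by move=> t _; rewrite lee_fin !mulr_ge0// powR_ge0.
  - apply/measurable_EFinP; apply: measurable_funM.
      by apply: measurable_fun_nat_of_bool; exact: measurable_fun_ltr.
    apply: measurable_funM; last exact: measurable_fun_powR_cst.
    exact: measurable_funM.
  - exact: mulr_ge0.
rewrite [leRHS]EFinM; apply: lee_wpmul2l; first by rewrite lee_fin mulr_ge0.
apply: le_trans (HB _ s0); rewrite [leRHS]integral_mkcond.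
apply: le_integral_nonneg => t _.
  by rewrite lee_fin !mulr_ge0// powR_ge0.
rewrite patchE mem_setE in_itv/= andbT.
have [/(lt_trans s0) t0|_] := boolP (s < t); last by rewrite /= !mul0r.
by rewrite mul1r powR_inv1 ?(ltW t0).
Qed.

End near_and_far_parts.

(** * Power integrals and layer-cake estimates *)

Section power_integral.
Variable R : realType.
Local Notation leb := (@lebesgue_measure R).

Lemma powRN_cvgy0 (c : R) : 0 < c -> x `^ (- c) @[x --> +oo] --> (0 : R).
Proof.
move=> c0; apply/cvgrPdist_le => e e0; near=> x.
have x0 : 0 < x by near: x; exact: nbhs_pinfty_gt.
rewrite sub0r normrN ger0_norm ?powR_ge0// powRN invf_ple ?posrE ?powR_gt0//.
rewrite -[leLHS](_ : (e^-1 `^ c^-1) `^ c = _); last first.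
  by rewrite -powRrM mulVf ?gt_eqF// powRr1// invr_ge0 ltW.
apply: ge0_ler_powR; rewrite ?nnegrE ?powR_ge0 ?(ltW c0) ?(ltW x0)//.
Unshelve. all: by end_near. Qed.

Lemma continuous_powR (c x : R) : 0 < x -> {for x, continuous (fun y : R => y `^ c)}.
Proof.
move=> x0; apply: differentiable_continuous; apply/derivable1_diffP.
by apply: derivable_powR; rewrite in_itv/= x0.
Qed.

Lemma integral_powRN_itvcy (b q : R) : 0 < b -> 1 < q ->
  (\int[leb]_(w in `[b, +oo[) (w `^ (- q))%:E = (b `^ (1 - q) / (q - 1))%:E)%E.
Proof.
move=> b0 q1; have q10 : q - 1 != 0 by rewrite gt_eqF// subr_gt0.
pose F (w : R) : R := (1 - q)^-1 * w `^ (1 - q).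
have dF (x : R) : 0 < x -> is_derive x 1 F (x `^ (- q)).
  move=> x0; have h := is_derive1_powR (1 - q) x0.
  have := is_deriveZ (1 - q)^-1 h.
  move=> /is_derive_eq; apply.
  rewrite /GRing.scale/= mulrA mulVf ?mul1r; last by rewrite -opprB oppr_eq0.
  by congr powR; ring.
rewrite (@ge0_continuous_FTC2y _ _ F b 0).
- rewrite sub0e -EFinN; congr EFin; rewrite /F -mulNr -invrN opprB mulrC.
  by [].
- by move=> x _; exact: powR_ge0.
- apply: continuous_in_subspaceT => x; rewrite inE/= in_itv/= andbT => bx.
  exact: continuous_powR (lt_le_trans b0 bx).
- rewrite -[X in _ --> X](mulr0 (1 - q)^-1); apply: cvgMr.
  by rewrite -opprB; apply: powRN_cvgy0; rewrite subr_gt0.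
- by move=> x bx; case: (dF x (lt_trans b0 bx)).
- apply: cvg_at_right_filter; apply: cvgMr; exact: continuous_powR.
- by move=> x; rewrite in_itv/= andbT => bx; rewrite derive1E; case: (dF x (lt_trans b0 bx)).
Qed.

End power_integral.

Section layers.
Variable R : realType.
Local Notation leb := (@lebesgue_measure R).

(* A layer-cake lower bound, over the levels [c / w ^ e], [w > 0]. *)
Lemma poweR_le_layers (X : \bar R) (c e q : R) : (0 <= X)%E -> 0 < c -> 0 < e ->
  1 < q ->
  (X `^ (q / e) <= (2 `^ (q + 1) * c `^ (q / e))%:E *
    \int[leb]_w ((0 < w)%R%:R * w `^ (- (q + 1)) *
                 ((c * w `^ (- e))%:E < X)%E%:R)%:E)%E.
Proof.
move=> X0 c0 e0 q1; set I := (\int[leb]_w _)%E.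
have qe0 : 0 < q / e by rewrite divr_gt0// (lt_trans ltr01).
have I0 : (0 <= I)%E.
  by apply: integral_ge0 => w _; rewrite lee_fin mulr_ge0 ?ler0n// mulr_ge0 ?ler0n// powR_ge0.
(* Every [w] in [(1/Y, 2/Y)] satisfies [c * w^(-e) < c * Y^e <= X], and [w^(-(q+1))] is at least its
   value at [2/Y]; multiplying by the length [1/Y] gives [2^(-(q+1)) * Y^q]. *)
have key (Y : R) : 0 < Y -> ((c * Y `^ e)%:E <= X)%E ->
    ((Y `^ q)%:E <= (2 `^ (q + 1))%:E * I)%E.
  move=> Y0 YX; pose J := `]Y^-1, 2 * Y^-1[%classic : set (measurableTypeR R).
  have Yi : 0 < Y^-1 by rewrite invr_gt0.
  pose b := (2 * Y^-1) `^ (- (q + 1)).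
  apply: (@le_trans _ _ ((2 `^ (q + 1))%:E * \int[leb]_(w in J) b%:E)%E).
    rewrite integral_cst; last exact: measurable_itv.
    rewrite /= lebesgue_measure_itv/= lte_fin ifT; last by lra.
    rewrite -EFinD -!EFinM lee_fin /b powRM ?(ltW Yi)//.
    have -> : Y^-1 `^ (- (q + 1)) = Y `^ q * Y.
      rewrite -(powR_inv1 (ltW Y0)) -powRrM mulN1r opprK.
      by rewrite powRD ?(gt_eqF Y0) ?implybT// powRr1 ?(ltW Y0).
    rewrite powRN le_eqVlt; apply/orP; left; apply/eqP; field.
    by rewrite !gt_eqF ?powR_gt0.
  apply: lee_wpmul2l; first by rewrite lee_fin powR_ge0.
  rewrite integral_mkcond; apply: le_integral_nonneg => w _.
    by apply: erestrict_ge0 => ? _; rewrite lee_fin powR_ge0.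
  rewrite patchE; case: ifPn; last first.
    by move=> _; rewrite lee_fin mulr_ge0 ?ler0n// mulr_ge0 ?ler0n// powR_ge0.
  rewrite inE /J /= in_itv/= => /andP[Yw wY].
  have w0 : 0 < w by exact: lt_trans Yw.
  rewrite w0 mul1r (_ : (_ < X)%E = true) ?mulr1.
    rewrite lee_fin /b !powRN lef_pV2 ?posrE ?powR_gt0//; last by rewrite mulr_gt0.
    apply: ge0_ler_powR; rewrite ?nnegrE; lra.
  apply: lt_le_trans YX; rewrite lte_fin ltr_pM2l// powRN.
  rewrite -[ltRHS]invrK ltf_pV2 ?posrE ?invr_gt0 ?powR_gt0// -powRN.
  rewrite -mulN1r powRrM powR_inv1 ?(ltW Y0)//.
  by apply: gt0_ltr_powR; rewrite ?nnegrE// ltW.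
move: I I0 key; move: X X0 => [r||] X0 I I0 key //.
  move: X0; rewrite lee_fin le_eqVlt => /predU1P[<-|r0].
    rewrite poweR_EFin powR0 ?gt_eqF//.
    by apply: mule_ge0 => //; rewrite lee_fin mulr_ge0// powR_ge0.
  have rc : 0 < r / c by rewrite divr_gt0.
  (* For finite [X] the largest admissible [Y] is the one with [c * Y^e = X]. *)
  have := key ((r / c) `^ e^-1).
  rewrite powR_gt0// -!powRrM mulVf ?gt_eqF// powRr1 ?(ltW rc)//.
  rewrite mulrCA mulfV ?gt_eqF// mulr1 => /(_ isT (lexx _)) h.
  rewrite poweR_EFin [(2 `^ _ * _)%R]mulrC [in leRHS]EFinM -muleA.
  apply: le_trans (lee_wpmul2l _ h); rewrite ?lee_fin ?powR_ge0//.
  by rewrite (mulrC e^-1) -powRM ?(ltW c0) ?(ltW rc)// mulrCA mulfV ?mulr1// (gt_eqF c0).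
rewrite poweRyr ?gt_eqF// leye_eq.
suff -> : I = +oo%E.
  by rewrite mulry gtr0_sg ?mul1e// mulr_gt0 ?powR_gt0.
(* Here [X] is infinite and every [Y] is admissible; the one with [Y^q = A * 2^(q+1)] gives
   [A <= I]. *)
apply/eqyP => A A0.
have p2 : 0 < 2 `^ (q + 1) :> R by rewrite powR_gt0.
have := key ((A * 2 `^ (q + 1)) `^ q^-1).
rewrite powR_gt0 ?mulr_gt0// -!powRrM mulVf ?gt_eqF ?(lt_trans ltr01)//.
rewrite powRr1 ?mulr_ge0 ?(ltW A0) ?(ltW p2)// => /(_ isT (leey _)).
by rewrite mulrC EFinM lee_pmul2l.
Qed.

(** Only [w > 1 / H] contributes, and [q > 1] makes [w^(-q)] integrable there. With [H = h z] this
    sums the weak-type bounds over all levels. *)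
Lemma integral_upper_layers (H q : R) : 0 < H -> 1 < q ->
  (\int[leb]_w ((0 < w)%R%:R * w `^ (- q) * (w `^ (-1) < H)%R%:R)%:E
    <= (H `^ (q - 1) / (q - 1))%:E)%E.
Proof.
move=> H0 q1; have Hi : 0 < H^-1 by rewrite invr_gt0.
apply: (@le_trans _ _ (\int[leb]_(w in `[(H^-1)%R, +oo[) (w `^ (- q))%:E)%E).
  rewrite [leRHS]integral_mkcond; apply: le_integral_nonneg => w _.
    by rewrite lee_fin mulr_ge0 ?ler0n// mulr_ge0 ?ler0n// powR_ge0.
  have [w0|_] := ltP 0 w; last first.
    rewrite /= !mul0r; apply: erestrict_ge0 => ? _.
    by rewrite lee_fin powR_ge0.
  rewrite powR_inv1 ?(ltW w0)// patchE mem_setE in_itv/= andbT mul1r.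
  have [wH|] := ltP (w^-1) H; last first.
    by rewrite mulr0; case: ifPn => //; rewrite lee_fin powR_ge0.
  rewrite mulr1 ifT// invf_ple ?posrE// ltW//.
rewrite integral_powRN_itvcy// lee_fin -(powR_inv1 (ltW H0)) -powRrM mulN1r.
by rewrite opprB.
Qed.

End layers.

(** * Interpolation, weak type and strong type for potentials *)

Section potential.
Variables (R : realType) (d : nat) (k : Rd R d -> Rd R d -> R) (phi : R -> R).
Variables (e K : R).
Local Notation mu := (lebesgueRd R d).
Local Notation leb := (@lebesgue_measure R).
Implicit Types (x y z : Rd R d) (h : Rd R d -> R).

Definition potential h x : \bar R := \int[mu]_z (k x z * h z)%:E.

Hypotheses (k_ge0 : forall x z, 0 <= k x z) (kC : forall x z, k x z = k z x).
Hypothesis mk : forall disp (T : measurableType disp) (f g : T -> Rd R d),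
  measurable_fun setT f -> measurable_fun setT g ->
  measurable_fun setT (fun a => k (f a) (g a)).
Hypotheses (phi_surj : set_surj `]0, +oo[ `]0, +oo[ phi).
Hypotheses (e0 : 0 < e) (K0 : 0 <= K)
  (near : near_bound k phi e K) (far : far_bound k phi e K).

Let level (u : R) : 0 < u -> exists2 s, 0 < s & phi s = u.
Proof.
move=> u0; have [|s /=] := phi_surj (_ : `]0, +oo[%classic u).
  by rewrite /= in_itv/= u0.
by rewrite in_itv/= andbT => s0 <-; exists s.
Qed.

Lemma potential_ge0 h x : (forall z, 0 <= h z) -> (0 <= potential h x)%E.
Proof. by move=> h0; apply: integral_ge0 => z _; rewrite lee_fin mulr_ge0. Qed.

Lemma measurable_potential h : measurable_fun setT h -> (forall z, 0 <= h z) ->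
  measurable_fun setT (potential h).
Proof.
move=> mh h0; apply: (@measurable_fun_fubini_tonelli_F _ _ _ _ _ mu
  (fun a => (k a.1 a.2 * h a.2)%:E)); last first.
  by move=> a; rewrite lee_fin mulr_ge0.
apply/measurable_EFinP; apply: measurable_funM; first exact: mk.
exact: measurableT_comp.
Qed.

Lemma measurable_kernel_near h x s : measurable_fun setT h ->
  measurable_fun setT (fun z => k x z * h z * (edist x z < s)%R%:R).
Proof.
move=> mh; apply: measurable_funM.
  by apply: measurable_funM => //; exact: mk.
by apply: measurable_fun_nat_of_bool; apply: measurable_fun_ltr => //;
  exact: measurable_fun_edist.
Qed.

Lemma potential_split h x s : measurable_fun setT h -> (forall z, 0 <= h z) ->
  (potential h x = \int[mu]_z (k x z * h z * (edist x z < s)%R%:R)%:E +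
    \int[mu]_z (k x z * h z * (s <= edist x z)%R%:R)%:E)%E.
Proof.
move=> mh h0; rewrite -ge0_integralD//.
- apply: eq_integral => z _; rewrite -EFinD -mulrDr ltNge.
  by case: (s <= _); rewrite ?addr0 ?add0r mulr1.
- by move=> z _; rewrite lee_fin mulr_ge0 ?ler0n ?mulr_ge0.
- by apply/measurable_EFinP; apply: measurable_kernel_near.
- by move=> z _; rewrite lee_fin mulr_ge0 ?ler0n ?mulr_ge0.
apply/measurable_EFinP; apply: measurable_funM.
  by apply: measurable_funM => //; exact: mk.
by apply: measurable_fun_nat_of_bool; apply: measurable_fun_ler => //;
  exact: measurable_fun_edist.
Qed.

(** At a radius with [phi s = A / M] the near bound [A * phi^(e-1)] and the far bound [M * phi^e]
    coincide. *)
Let powR_balance (A M : R) : 0 < A -> 0 < M ->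
  A * (A / M) `^ (e - 1) = A `^ e * M `^ (1 - e) /\
  M * (A / M) `^ e = A `^ e * M `^ (1 - e).
Proof.
move=> A0 M0; have Mi : 0 <= M^-1 by rewrite invr_ge0 ltW.
rewrite !powRM ?(ltW A0)// -!powR_inv1 ?(ltW M0)// -!powRrM !mulN1r opprB.
split.
  by rewrite mulrA mulr_powRB1// ltW.
rewrite mulrCA; congr (_ * _).
by rewrite -{1}(powRr1 (ltW M0)) -powRD// (gt_eqF M0) implybT.
Qed.

(* Hedberg's argument: split at the radius where [phi s = A / M]. *)
Lemma potential_le_interpolation h x (A M : R) :
  measurable_fun setT h -> (forall z, 0 <= h z) -> 0 <= A -> 0 < M ->
  (forall t, 0 < t ->
    (\int[mu]_(z in eball x (2 * t)) (h z)%:E <= (t ^+ d * A)%:E)%E) ->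
  (forall t, 0 < t ->
    (\int[mu]_(z in eball x (2 * t)) (h z)%:E <= (t ^+ d * (M * phi t))%:E)%E) ->
  (potential h x <= (K * 2 * (A `^ e * M `^ (1 - e)))%:E)%E.
Proof.
move=> mh h0 A0 M0 hA hM; move: A0; rewrite le_eqVlt => /predU1P[A0|A0].
  (* For [A = 0] the ratio [A / M] is not a value of [phi]. The near part is then [0] at every
     radius, and the far part is made smaller than [eps] by a small level of [phi]. *)
  rewrite -A0 powR0 ?gt_eqF// mul0r mulr0; apply/lee_addgt0Pr => eps eps0.
  rewrite add0e.
  have KM : 0 < K * M + 1 by rewrite ltr_wpDl// mulr_ge0// ltW.
  have c0 : 0 < (eps / (K * M + 1)) `^ e^-1 by rewrite powR_gt0 ?divr_gt0.
  have [s s0 phis] := level c0.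
  rewrite (potential_split x s mh h0).
  have hA' : forall t, 0 < t ->
    (\int[mu]_(z in eball x (2 * t)) (h z)%:E <= (t ^+ d * 0)%:E)%E.
    by move=> t t0; rewrite A0; exact: hA.
  apply: (le_trans (leeD (near mh h0 (lexx 0) s0 hA') (far mh h0 (ltW M0) s0 hM))).
  rewrite -EFinD lee_fin mulr0 mul0r add0r phis -powRrM mulVf ?gt_eqF// powRr1.
    rewrite mulrA ler_pdivrMr// mulrC ler_wpM2l ?(ltW eps0)//.
    by rewrite lerDl.
  by rewrite divr_ge0// ltW.
have [s s0 phis] := level (divr_gt0 A0 M0).
rewrite (potential_split x s mh h0).
apply: (le_trans (leeD (near mh h0 (ltW A0) s0 hA) (far mh h0 (ltW M0) s0 hM))).
rewrite -EFinD lee_fin phis -!mulrA.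
have [-> ->] := powR_balance A0 M0.
by rewrite mulrA -mulrDl; rewrite le_eqVlt; apply/orP; left; apply/eqP; ring.
Qed.

Lemma integral_eball_le h x t (u : R) : 0 < t -> 0 <= u ->
  (forall z, 0 <= h z <= u) ->
  (\int[mu]_(z in eball x (2 * t)) (h z)%:E <= (t ^+ d * (4 ^+ d * u))%:E)%E.
Proof.
move=> t0 u0 hu; apply: (@le_trans _ _ (\int[mu]_(z in eball x (2 * t)) u%:E)%E).
  by apply: le_integral_nonneg => z _; rewrite lee_fin; case/andP: (hu z).
rewrite integral_cst; last exact: measurable_eball.
apply: (@le_trans _ _ (u%:E * ((2 * t *+ 2) ^+ d)%:E)%E).
  by apply: lee_wpmul2l; rewrite ?lee_fin//; apply: eball_measure_le; lra.
rewrite -EFinM lee_fin mulrA -exprMn mulrC ler_wpM2r//.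
by rewrite le_eqVlt; apply/orP; left; apply/eqP; congr (_ ^+ _); ring.
Qed.

(** Cut [h] at height [u] and take [phi s = u / M], so that [l = u^e M^(1-e)] is the balanced value.
    The near part of [h1] costs [K * 4^d * l] and the far part of [h] costs [K * l], so on the given
    set the near part [G] of [h2] exceeds [l]. Markov's inequality and Tonelli then leave the
    integral of [h2]. *)
Lemma potential_weak_type h (M u : R) :
  measurable_fun setT h -> (forall z, 0 <= h z) -> 0 < M -> 0 < u ->
  (forall x t, 0 < t ->
    (\int[mu]_(z in eball x (2 * t)) (h z)%:E <= (t ^+ d * (M * phi t))%:E)%E) ->
  (mu [set x | (((K * 4 ^+ d + K + 1) * (u `^ e * M `^ (1 - e)))%:E
                 < potential h x)%E]
   <= (K * 4 ^+ d / u)%:E * \int[mu]_z (h z * (u < h z)%R%:R)%:E)%E.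
Proof.
move=> mh h0 M0 u0 hM.
have [s s0 phis] := level (divr_gt0 u0 M0).
have [bal1 bal2] := powR_balance u0 M0.
set l := u `^ e * M `^ (1 - e) in bal1 bal2 *.
have l0 : 0 < l by rewrite mulr_gt0// powR_gt0.
pose h1 z := h z * (h z <= u)%R%:R; pose h2 z := h z * (u < h z)%R%:R.
have mh1 : measurable_fun setT h1.
  by apply: measurable_funM => //; apply: measurable_fun_nat_of_bool;
    exact: measurable_fun_ler.
have mh2 : measurable_fun setT h2.
  by apply: measurable_funM => //; apply: measurable_fun_nat_of_bool;
    exact: measurable_fun_ltr.
have h10 z : 0 <= h1 z by rewrite mulr_ge0 ?ler0n.
have h20 z : 0 <= h2 z by rewrite mulr_ge0 ?ler0n.
have h1u z : 0 <= h1 z <= u.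
  rewrite h10/= /h1; case: (leP (h z) u); first by rewrite mulr1.
  by rewrite mulr0 ltW.
pose G x := (\int[mu]_z (k x z * h2 z * (edist x z < s)%R%:R)%:E)%E.
have mF : measurable_fun setT (fun a : Rd R d * Rd R d =>
    k a.1 a.2 * h2 a.2 * (edist a.1 a.2 < s)%R%:R).
  apply: measurable_funM.
    by apply: measurable_funM; [exact: mk|exact: measurableT_comp].
  by apply: measurable_fun_nat_of_bool; apply: measurable_fun_ltr => //;
    exact: measurable_fun_edist.
have F0 (a : Rd R d * Rd R d) :
    (0 <= (k a.1 a.2 * h2 a.2 * (edist a.1 a.2 < s)%R%:R)%:E)%E.
  by rewrite lee_fin mulr_ge0 ?ler0n// mulr_ge0.
have mG : measurable_fun setT G.
  apply: (@measurable_fun_fubini_tonelli_F _ _ _ _ _ mu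
    (fun a => (k a.1 a.2 * h2 a.2 * (edist a.1 a.2 < s)%R%:R)%:E)) => //.
  exact/measurable_EFinP.
have u4 : 0 <= 4 ^+ d * u by rewrite mulr_ge0// ?exprn_ge0// ltW.
have potG x : (potential h x <= (K * 4 ^+ d * l + K * l)%:E + G x)%E.
  rewrite (potential_split x s mh h0).
  have -> : (\int[mu]_z (k x z * h z * (edist x z < s)%R%:R)%:E =
      \int[mu]_z (k x z * h1 z * (edist x z < s)%R%:R)%:E + G x)%E.
    rewrite -ge0_integralD//.
    - apply: eq_integral => z _; rewrite -EFinD -mulrDl -mulrDr -mulrDr leNgt.
      by case: (u < _); rewrite ?addr0 ?add0r mulr1.
    - by move=> z _; rewrite lee_fin mulr_ge0 ?ler0n// mulr_ge0.
    - by apply/measurable_EFinP; apply: measurable_kernel_near.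
    - by move=> z _; rewrite lee_fin mulr_ge0 ?ler0n// mulr_ge0.
    - by apply/measurable_EFinP; apply: measurable_kernel_near.
  rewrite addeAC leeD2r// EFinD; apply: leeD.
    have := near mh1 h10 u4 s0 (fun t t0 => integral_eball_le x t0 (ltW u0) h1u).
    by rewrite phis -[K * (4 ^+ d * u) * _]mulrA -(mulrA (4 ^+ d)) bal1 !mulrA.
  by have := far mh h0 (ltW M0) s0 (hM x); rewrite phis -mulrA bal2.
set E := [set x | _].
have EG : E `<=` [set x | (l%:E < G x)%E].
  move=> x; rewrite /E/= => /lt_le_trans/(_ (potG x)).
  rewrite ltNge => /negP Gl; rewrite ltNge; apply/negP => lG; apply: Gl.
  apply: le_trans (leeD2l _ lG) _; rewrite -EFinD lee_fin.
  by rewrite !mulrDl mul1r.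
have mE : measurable E.
  rewrite -[X in measurable X]setTI; apply: emeasurable_fun_o_infty => //.
  exact: measurable_potential.
have mEG : measurable [set x | (l%:E < G x)%E].
  by rewrite -[X in measurable X]setTI; apply: emeasurable_fun_o_infty.
apply: (@le_trans _ _ (mu [set x | (l%:E < G x)%E])).
  by apply: le_measure => //; rewrite inE.
have markov : (l%:E * mu [set x | (l%:E < G x)%E] <= \int[mu]_x G x)%E.
  rewrite -integral_cst// [leLHS]integral_mkcond; apply: le_integral_nonneg.
    by move=> x _; apply: erestrict_ge0 => ? _; rewrite lee_fin ltW.
  move=> x _; rewrite patchE; case: ifPn; first by rewrite inE => /ltW.
  by move=> _; apply: integral_ge0 => z _; exact: (F0 (x, z)).
rewrite -(@lee_pmul2l _ l%:E) ?lte_fin//.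
apply: (le_trans markov); rewrite {1}/G.
rewrite (@fubini_tonelli _ _ _ _ _ mu mu
    (fun a => (k a.1 a.2 * h2 a.2 * (edist a.1 a.2 < s)%R%:R)%:E))//=; last first.
  exact/measurable_EFinP.
rewrite muleA -EFinM -ge0_integralZl_EFin//; last 3 first.
- by move=> z _; rewrite lee_fin; exact: h20.
- by apply/measurable_EFinP.
- by rewrite mulr_ge0 ?(ltW l0)// divr_ge0 ?(ltW u0)// mulr_ge0// exprn_ge0.
apply: le_integral_nonneg => z _.
  by apply: integral_ge0 => x _; exact: (F0 (x, z)).
(* By symmetry of the kernel, its integral in [x] over the points near [z] is bounded by [near]
   applied to the constant [1] around [z]. *)
have m1 : measurable_fun setT (cst 1 : Rd R d -> R) by [].
have -> : (\int[mu]_x (k x z * h2 z * (edist x z < s)%R%:R)%:E =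
    (h2 z)%:E * \int[mu]_x (k z x * cst 1 x * (edist z x < s)%R%:R)%:E)%E.
  rewrite -ge0_integralZl_EFin//.
  - apply: eq_integral => x _; rewrite -EFinM kC edistC; congr EFin.
    by rewrite /cst mulr1 (mulrC (k z x)) mulrA.
  - by move=> x _; rewrite lee_fin mulr_ge0 ?ler0n// mulr_ge0.
  - by apply/measurable_EFinP; apply: measurable_kernel_near.
rewrite muleC; apply: lee_wpmul2r; first by rewrite lee_fin.
have i1 (x : Rd R d) : 0 <= (cst 1 x : R) <= 1 by rewrite /= ler01 lexx.
have p4 : 0 <= 4 ^+ d * 1 :> R by rewrite mulr1 exprn_ge0.
apply: le_trans (near m1 (fun=> ler01) p4 s0
  (fun t t0 => integral_eball_le z t0 ler01 i1)) _.
rewrite lee_fin mulr1 phis le_eqVlt; apply/orP; left; apply/eqP.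
rewrite -[in RHS]bal1; field.
by rewrite gt_eqF.
Qed.

(** The layers [c * w^(-e)] with [c = L * M^(1-e)] are the levels of the weak-type bound at
    [u = 1 / w]. Its factor [1 / u = w] turns the density [w^(-(q+1))] into [w^(-q)], whose integral
    over [w > 1 / h z], times [h z], is a multiple of [(h z)^q]. The power of [M] is that of
    [c^(q/e)]. *)
Lemma potential_strong_type q h (M : R) : 1 < q ->
  measurable_fun setT h -> (forall z, 0 <= h z) -> 0 < M ->
  (forall x t, 0 < t ->
    (\int[mu]_(z in eball x (2 * t)) (h z)%:E <= (t ^+ d * (M * phi t))%:E)%E) ->
  (\int[mu]_x (potential h x `^ (q / e)) <=
    (2 `^ (q + 1) * (K * 4 ^+ d + K + 1) `^ (q / e) * (K * 4 ^+ d / (q - 1)) *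
     M `^ (q / e - q))%:E * \int[mu]_z (h z `^ q)%:E)%E.
Proof.
move=> q1 mh h0 M0 hM.
have K40 : 0 <= K * 4 ^+ d by rewrite mulr_ge0// exprn_ge0.
have L0 : 0 < K * 4 ^+ d + K + 1 by rewrite ltr_wpDl// addr_ge0.
set L := K * 4 ^+ d + K + 1 in L0 *.
have q10 : 0 < q - 1 by rewrite subr_gt0.
pose c := L * M `^ (1 - e).
have c0 : 0 < c by rewrite mulr_gt0// powR_gt0.
have mpot := measurable_potential mh h0.
have pot0 x : (0 <= potential h x)%E by exact: potential_ge0.
pose F (a : Rd R d * measurableTypeR R) : R := (0 < a.2)%R%:R * a.2 `^ (- (q + 1)) *
  ((c * a.2 `^ (- e))%:E < potential h a.1)%E%:R.
have F0 a : 0 <= F a.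
  by rewrite mulr_ge0 ?ler0n// mulr_ge0 ?ler0n// powR_ge0.
have mF : measurable_fun setT F.
  apply: measurable_funM; first apply: measurable_funM.
  - apply: measurable_fun_nat_of_bool; exact: measurable_fun_ltr.
  - exact: measurable_fun_powR_cst.
  apply: measurable_fun_nat_of_bool; apply: measurable_fun_lte; last exact: measurableT_comp.
  by apply/measurable_EFinP; apply: measurable_funM => //; exact: measurable_fun_powR_cst.
pose G (a : Rd R d * measurableTypeR R) : R :=
  (0 < a.2)%R%:R * a.2 `^ (- q) * (a.2 `^ (-1) < h a.1)%R%:R.
have G0 a : 0 <= G a.
  by rewrite mulr_ge0 ?ler0n// mulr_ge0 ?ler0n// powR_ge0.
have mG : measurable_fun setT G.
  apply: measurable_funM; first apply: measurable_funM.
  - apply: measurable_fun_nat_of_bool; exact: measurable_fun_ltr.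
  - exact: measurable_fun_powR_cst.
  apply: measurable_fun_nat_of_bool; apply: measurable_fun_ltr; last exact: measurableT_comp.
  exact: measurable_fun_powR_cst.
pose A := 2 `^ (q + 1) * c `^ (q / e).
have A0 : 0 <= A by rewrite mulr_ge0 ?powR_ge0.
(* the weak-type bound at the level [u = 1 / w] *)
have weak (w : R) : (\int[mu]_x (F (x, w))%:E <=
    (K * 4 ^+ d)%:E * \int[mu]_z (G (z, w) * h z)%:E)%E.
  rewrite /F /G/=; have [w0|_] := ltP 0 w; last first.
    rewrite [leLHS]integral0_eq => [|x _]; last by rewrite !mul0r.
    rewrite [X in (_ <= _ * X)%E]integral0_eq ?mule0// => x _.
    by rewrite !mul0r.
  have wi : 0 < w^-1 by rewrite invr_gt0.
  under eq_integral do rewrite mul1r EFinM.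
  rewrite ge0_integralZl_EFin ?powR_ge0//; last first.
    apply/measurable_EFinP; apply: measurable_fun_nat_of_bool.
    exact: measurable_fun_lte.
  set E := [set x | ((c * w `^ (- e))%:E < potential h x)%E].
  have mE : measurable E.
    by rewrite -[X in measurable X]setTI; apply: emeasurable_fun_o_infty.
  have -> : (\int[mu]_x ((c * w `^ (- e))%:E < potential h x)%E%:R%:E = mu E)%E.
    rewrite -[in RHS](setIT E) -integral_indic//; apply: eq_integral => x _.
    congr EFin; rewrite indicE; congr (nat_of_bool _)%:R.
    by apply/idP/idP => [?|]; [rewrite mem_set|rewrite inE].
  have := potential_weak_type mh h0 M0 wi hM.
  rewrite -/L -(powR_inv1 (ltW w0)) -powRrM mulN1r.
  have -> : L * (w `^ (- e) * M `^ (1 - e)) = c * w `^ (- e) by rewrite /c; ring.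
  rewrite -/E => wE.
  apply: (le_trans (lee_wpmul2l _ wE)); first by rewrite lee_fin powR_ge0.
  rewrite muleA -EFinM -!ge0_integralZl_EFin//.
  - apply: le_integral_nonneg => z _.
      rewrite -EFinM lee_fin mulr_ge0//; last by rewrite mulr_ge0 ?ler0n.
      by rewrite mulr_ge0 ?powR_ge0// divr_ge0 ?powR_ge0.
    rewrite -!EFinM lee_fin mul1r (powR_inv1 (ltW w0)) invrK.
    have -> : w `^ (- (q + 1)) = w `^ (- q) * w^-1.
      by rewrite opprD powRD ?(gt_eqF w0) ?implybT// (powR_inv1 (ltW w0)).
    rewrite le_eqVlt; apply/orP; left; apply/eqP; field.
    by rewrite gt_eqF.
  - by move=> z _; rewrite lee_fin !mulr_ge0// ?powR_ge0 ?ler0n.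
  - apply/measurable_EFinP; apply: measurable_funM => //.
    apply: measurable_funM => //; apply: measurable_fun_nat_of_bool.
    exact: measurable_fun_ltr.
  - by move=> z _; rewrite lee_fin mulr_ge0// ler0n.
  - apply/measurable_EFinP; apply: measurable_funM => //.
    apply: measurable_fun_nat_of_bool; exact: measurable_fun_ltr.
  - by rewrite mulr_ge0 ?powR_ge0// divr_ge0 ?powR_ge0.
apply: (@le_trans _ _ (\int[mu]_x (A%:E * \int[leb]_w (F (x, w))%:E))%E).
  apply: le_integral_nonneg => x _; first exact: poweR_ge0.
  exact: poweR_le_layers.
rewrite ge0_integralZl_EFin//; last 2 first.
- by move=> x _; apply: integral_ge0 => w _; rewrite lee_fin.
- apply: (@measurable_fun_fubini_tonelli_F _ _ _ _ _ leb (EFin \o F)) => //.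
  exact/measurable_EFinP.
rewrite (@fubini_tonelli _ _ _ _ _ mu leb (EFin \o F))//; last first.
  exact/measurable_EFinP.
have mGh : measurable_fun setT (fun a : Rd R d * measurableTypeR R => G a * h a.1).
  by apply: measurable_funM => //; exact: measurableT_comp.
apply: (@le_trans _ _ (A%:E * \int[leb]_w ((K * 4 ^+ d)%:E * \int[mu]_z (G (z, w) * h z)%:E))%E).
  apply: lee_wpmul2l; rewrite ?lee_fin//; apply: le_integral_nonneg => w _.
    by apply: integral_ge0 => x _; rewrite lee_fin.
  exact: weak.
rewrite ge0_integralZl_EFin//; last 2 first.
- by move=> w _; apply: integral_ge0 => x _; rewrite lee_fin mulr_ge0.
- apply: (@measurable_fun_fubini_tonelli_G _ _ _ _ _ mu
    (fun a : Rd R d * measurableTypeR R => (G a * h a.1)%:E)) => //.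
    exact/measurable_EFinP.
  by move=> a; rewrite lee_fin mulr_ge0.
rewrite -(@fubini_tonelli _ _ _ _ _ mu leb
    (fun a : Rd R d * measurableTypeR R => (G a * h a.1)%:E)); last 2 first.
- exact/measurable_EFinP.
- by move=> a; rewrite lee_fin mulr_ge0.
rewrite muleA -EFinM /=.
have cE : c `^ (q / e) = L `^ (q / e) * M `^ (q / e - q).
  rewrite powRM ?(ltW L0) ?powR_ge0// -powRrM; congr (_ * _ `^ _).
  by field; rewrite gt_eqF.
apply: (@le_trans _ _ ((A * (K * 4 ^+ d))%:E * ((q - 1)^-1%:E * \int[mu]_z (h z `^ q)%:E))%E); last first.
  rewrite muleA -EFinM /A cE le_eqVlt; apply/orP; left; apply/eqP.
  by congr (_%:E * _)%E; ring.
apply: lee_wpmul2l; first by rewrite lee_fin mulr_ge0.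
rewrite -ge0_integralZl_EFin//; last 3 first.
- by move=> z _; rewrite lee_fin powR_ge0.
- by apply/measurable_EFinP; exact: measurable_fun_powR_cst.
- by rewrite invr_ge0 ltW.
apply: le_integral_nonneg => z _.
  by apply: integral_ge0 => w _; rewrite lee_fin mulr_ge0.
have := h0 z; rewrite le_eqVlt => /predU1P[hz|hz].
  rewrite -hz integral0_eq => [|w _]; last by rewrite mulr0.
  by apply: mule_ge0; rewrite lee_fin ?powR_ge0// invr_ge0 ltW.
under eq_integral do rewrite mulrC EFinM.
rewrite ge0_integralZl_EFin//; last 2 first.
- by move=> w _; rewrite lee_fin.
- apply/measurable_EFinP; rewrite /G/=.
  apply: measurable_funM; first apply: measurable_funM.
  + apply: measurable_fun_nat_of_bool; exact: measurable_fun_ltr.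
  + exact: measurable_fun_powR_cst.
  + apply: measurable_fun_nat_of_bool; exact: measurable_fun_ltr.
apply: (le_trans (lee_wpmul2l _ (integral_upper_layers hz q1))).
  by rewrite lee_fin ltW.
rewrite -!EFinM lee_fin mulrA mulr_powRB1 ?(ltW hz) ?(lt_trans ltr01 q1)//.
by rewrite mulrC.
Qed.

End potential.

(** * Powers of extended reals *)

Section extended_powers.
Variable R : realType.
Local Open Scope ereal_scope.
Implicit Types (x y : \bar R) (r : R).

Lemma lee_poweR r x y : (0 <= r)%R -> 0 <= x -> x <= y -> x `^ r <= y `^ r.
Proof.
move=> r0 x0 xy; apply: gt0_ler_poweR => //; rewrite in_itv/= leey andbT//.
exact: le_trans xy.
Qed.

Lemma poweR_le_inv r x y : (0 < r)%R -> 0 <= x -> 0 <= y ->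
  x `^ r <= y `^ r -> x <= y.
Proof.
move=> r0 x0 y0 /(lee_poweR (_ : (0 <= r^-1)%R)).
rewrite invr_ge0 (ltW r0) poweR_ge0 -!poweRrM divff ?gt_eqF// !poweRe1//.
exact.
Qed.

(** From [x + y <= 2 * max x y], which treats exponents below and above [1] alike. *)
Lemma poweRD_le r x y : (0 <= r)%R -> 0 <= x -> 0 <= y ->
  (x + y) `^ r <= (2 `^ r)%:E * (x `^ r + y `^ r).
Proof.
move=> r0; wlog xy : x y / x <= y => [hw|].
  move=> x0 y0; have [xy|/ltW yx] := leP x y; first exact: hw.
  by rewrite addeC (addeC (x `^ r)); exact: hw.
move=> x0 y0; apply: (@le_trans _ _ ((2%:E * y) `^ r)).
  apply: lee_poweR => //; first exact: adde_ge0.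
  rewrite -[leRHS]/((1 + 1)%R%:E * y) (EFinD 1 1) ge0_muleDl//.
  by rewrite mul1e leeD2r.
rewrite poweRM// poweR_EFin; apply: lee_wpmul2l; first by rewrite lee_fin powR_ge0.
by rewrite leeDr// poweR_ge0.
Qed.

End extended_powers.

(** * Ball masses and amalgam bounds *)

Section ball_mass.
Variables (R : realType) (d : nat).
Local Notation mu := (lebesgueRd R d).
Implicit Types (x y z : Rd R d) (g h : Rd R d -> R) (t : R).

Local Notation powf g q := (fun z => (g z `^ q)%R).

Definition ball_mass h y t : \bar R := \int[mu]_(z in eball y t) (h z)%:E.

Lemma ball_massE h y t : (forall z, 0 <= h z) ->
  ball_mass h y t = (\int[mu]_z (h z * (edist y z < t)%R%:R)%:E)%E.
Proof.
move=> h0; rewrite /ball_mass integral_mkcond; apply: eq_integral => z _.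
rewrite patchE; case: ifPn; first by rewrite inE /eball/= edistC => ->; rewrite mulr1.
by rewrite notin_setE /eball/= edistC => /negP/negbTE ->; rewrite mulr0.
Qed.

Lemma ball_mass_ge0 h y t : (forall z, 0 <= h z) -> (0 <= ball_mass h y t)%E.
Proof. by move=> h0; apply: integral_ge0 => z _; rewrite lee_fin. Qed.

Lemma measurable_ball_mass h : measurable_fun setT h -> (forall z, 0 <= h z) ->
  measurable_fun setT (fun a : Rd R d * measurableTypeR R => ball_mass h a.1 a.2).
Proof.
move=> mh h0; under eq_fun do rewrite ball_massE//.
apply: (@measurable_fun_fubini_tonelli_F _ _ _ _ _ mu
  (fun b : (Rd R d * measurableTypeR R) * Rd R d =>
     (h b.2 * (edist b.1.1 b.2 < b.1.2)%R%:R)%:E)); last first.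
  by move=> b; rewrite lee_fin mulr_ge0 ?ler0n.
apply/measurable_EFinP; apply: measurable_funM; first exact: measurableT_comp.
apply: measurable_fun_nat_of_bool; apply: measurable_fun_ltr.
  apply: measurable_fun_edist => //; exact: measurableT_comp.
exact: measurableT_comp.
Qed.

Lemma measurable_ball_mass1 h t : measurable_fun setT h -> (forall z, 0 <= h z) ->
  measurable_fun setT (fun y => ball_mass h y t).
Proof.
move=> mh h0; apply: (@measurableT_comp _ _ _ _ _ _
  (fun a : Rd R d * measurableTypeR R => ball_mass h a.1 a.2) _ (fun y => (y, t))).
  exact: measurable_ball_mass.
exact: measurable_fun_pair.
Qed.

(** The comparison is asked only where [g] is positive, so that a function cut off inside a ball can
    be compared by its support alone. *)
Lemma le_ball_mass g h x y s t :
  (forall z, 0 <= g z) -> (forall z, 0 <= h z) ->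
  (forall z, edist x z < s -> 0 < g z -> edist y z < t /\ g z <= h z) ->
  (ball_mass g x s <= ball_mass h y t)%E.
Proof.
move=> g0 h0 gh; rewrite !ball_massE//; apply: le_integral_nonneg => z _.
  by rewrite lee_fin mulr_ge0 ?ler0n.
have := g0 z; rewrite le_eqVlt => /predU1P[<-|gz].
  by rewrite mul0r lee_fin mulr_ge0 ?ler0n.
have [xz|_] := ltP (edist x z) s; last by rewrite mulr0 lee_fin mulr_ge0 ?ler0n.
by have [-> ?] := gh _ xz gz; rewrite !mulr1 lee_fin.
Qed.

(* From [g <= a + a^(1-q) g^q]. *)
Lemma ball_mass_young (q : R) g x t (a b : R) : 1 < q -> measurable_fun setT g ->
  (forall z, 0 <= g z) -> 0 < t -> 0 <= a -> 0 <= b ->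
  (ball_mass (powf g q) x (2 * t) <= (t ^+ d * (b * a `^ q))%:E)%E ->
  (ball_mass g x (2 * t) <= (t ^+ d * ((4 ^+ d + b) * a))%:E)%E.
Proof.
move=> q1 mg g0 t0 a0 b0.
have td : 0 < t ^+ d by rewrite exprn_gt0.
(* The factor [a^(1-q)] calls for [a > 0]; the case [a = 0] follows from arbitrarily small positive
   [a]. *)
wlog : a a0 / 0 < a => [hw|a_gt0].
  move: (a0); rewrite le_eqVlt => /predU1P[<-|/hw]; last exact.
  rewrite powR0 ?gt_eqF ?(lt_trans ltr01)// !mulr0 => H.
  apply/lee_addgt0Pr => eps eps0; rewrite add0e.
  have c0 : 0 < t ^+ d * (4 ^+ d + b) by rewrite mulr_gt0// ltr_pwDl// exprn_gt0.
  have e0 : 0 < eps / (t ^+ d * (4 ^+ d + b)) by rewrite divr_gt0.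
  apply: le_trans (hw _ (ltW e0) e0 _) _.
    by apply: (le_trans H); rewrite lee_fin mulr_ge0 ?(ltW td)// mulr_ge0// powR_ge0.
  by rewrite lee_fin mulrA mulrC divfK ?gt_eqF.
move=> H.
have key z : g z <= a + a `^ (1 - q) * g z `^ q.
  have [ga|ag] := leP (g z) a.
    by rewrite (le_trans ga)// lerDl mulr_ge0 ?powR_ge0.
  have g1 : 0 < g z by exact: lt_trans ag.
  rewrite -[leLHS]add0r lerD//.
  rewrite -(powRr1 (g0 z)) -[X in g z `^ X <= _](subrK q 1) powRD; last first.
    by rewrite (gt_eqF g1) implybT.
  rewrite powRr1// ler_wpM2r ?powR_ge0// -opprB !powRN lef_pV2 ?posrE ?powR_gt0//.
  by apply: ge0_ler_powR; rewrite ?nnegrE ?(ltW g1) ?(ltW ag)// subr_ge0 ltW.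
apply: (@le_trans _ _ (a%:E * mu (eball x (2 * t)) +
    (a `^ (1 - q))%:E * ball_mass (powf g q) x (2 * t))%E).
  have mB := measurable_eball x (2 * t).
  rewrite -integral_cst// /ball_mass -ge0_integralZl_EFin//; last 3 first.
  - by move=> z _; rewrite lee_fin powR_ge0.
  - apply/measurable_EFinP; apply: (measurable_funS measurableT) => //.
    exact: measurable_fun_powR_cst.
  - exact: powR_ge0.
  rewrite -ge0_integralD//; last 2 first.
  - by move=> z _; rewrite -EFinM lee_fin mulr_ge0 ?powR_ge0.
  - under eq_fun do rewrite -EFinM.
    apply/measurable_EFinP; apply: (measurable_funS measurableT) => //.
    by apply: measurable_funM => //; exact: measurable_fun_powR_cst.
  apply: le_integral_nonneg => z _; first by rewrite lee_fin.
  by rewrite /= -EFinM -EFinD lee_fin.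
have : ((a `^ (1 - q))%:E * ball_mass (powf g q) x (2 * t) <=
    (a `^ (1 - q))%:E * (t ^+ d * (b * a `^ q))%:E)%E.
  by apply: lee_wpmul2l; rewrite ?lee_fin ?powR_ge0.
have : (a%:E * mu (eball x (2 * t)) <= a%:E * ((2 * t *+ 2) ^+ d)%:E)%E.
  by apply: lee_wpmul2l; rewrite ?lee_fin//; apply: eball_measure_le; lra.
move=> h1 h2; apply: (le_trans (leeD h1 h2)); rewrite -!EFinM -EFinD lee_fin.
have -> : 2 * t *+ 2 = 4 * t by ring.
rewrite (mulrCA (a `^ _)) (mulrCA (a `^ _)) -powRD ?(gt_eqF a_gt0) ?implybT//.
rewrite subrK powRr1// exprMn le_eqVlt; apply/orP; left; apply/eqP; ring.
Qed.

End ball_mass.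

Section amalgam_bound.
Variables (R : realType) (d : nat) (q p D : R) (phi : R -> R).
Local Notation mu := (lebesgueRd R d).
Implicit Types (x y z : Rd R d) (g h : Rd R d -> R) (t M : R).
Local Notation powf g q := (fun z => (g z `^ q)%R).

(** For [g] equal to [|f|] off a null set, this is [fofana_norm phi q p f <= M] with the roots
    removed: at each radius the amalgam norm is at most [M * phi t * t^(d/q) * t^(d/p)], and both
    sides are raised to the power [p]. *)
Definition amalgam_bound g M := forall t, 0 < t ->
  (\int[mu]_y (ball_mass (powf g q) y t `^ (p / q)) <=
    ((M * phi t) `^ p * ((t ^+ d) `^ (p / q) * t ^+ d))%:E)%E.

Hypotheses (q1 : 1 < q) (qp : q <= p) (D0 : 0 < D).
Hypothesis phi_gt0 : forall t, 0 < t -> 0 < phi t.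
Hypothesis phi_dec : forall s t, 0 < s -> s <= t -> phi t <= D * phi s.

Let q0 : 0 < q. Proof. exact: lt_trans q1. Qed.
Let p0 : 0 < p. Proof. exact: lt_le_trans qp. Qed.
Let P0 : 0 < p / q. Proof. exact: divr_gt0. Qed.

(* Every ball [B(y, 2t)] with [y] in [B(x, t)] contains [B(x, t)]. *)
Lemma ball_mass_le_amalgam : exists2 b, 0 < b & forall g M x t,
  measurable_fun setT g -> (forall z, 0 <= g z) -> 0 < M ->
  amalgam_bound g M -> 0 < t ->
  (ball_mass (powf g q) x t <= (t ^+ d * (b * (M * phi t) `^ q))%:E)%E.
Proof.
(* [a^(p/q)] is the ratio of [(2 t)^d] to [(t / (d + 1))^d], the lower bound for the volume of
   [B(x, t)]. With it, [X] below solves the equation [XP] between a constant integrated over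
   [B(x, t)] and the amalgam bound at radius [2 t]. *)
pose a : R := (2 ^+ d * d.+1%:R ^+ d) `^ (q / p).
have n0 : (0 : R) < d.+1%:R by [].
have a0 : 0 < a by rewrite powR_gt0// mulr_gt0 ?exprn_gt0.
exists (2 ^+ d * a * D `^ q).
  by rewrite !mulr_gt0 ?powR_gt0// exprn_gt0.
move=> g M x t mg g0 M0 gM t0; set m := ball_mass _ _ _.
have td : 0 < t ^+ d by rewrite exprn_gt0.
have gq0 z : 0 <= g z `^ q by exact: powR_ge0.
have m0 : (0 <= m)%E by exact: ball_mass_ge0.
have phit := phi_gt0 t0.
have phi2t : 0 < phi (2 * t) by apply: phi_gt0; rewrite mulr_gt0.
pose X := (M * phi (2 * t)) `^ q * ((2 * t) ^+ d * a).
have t20 : 0 < (2 * t) ^+ d by rewrite exprn_gt0// mulr_gt0.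
have X0 : 0 < X by rewrite mulr_gt0 ?mulr_gt0 ?powR_gt0// mulr_gt0.
suff mX : (m <= X%:E)%E.
  apply: (le_trans mX); rewrite lee_fin.
  have -> : t ^+ d * (2 ^+ d * a * D `^ q * (M * phi t) `^ q) =
      (D `^ q * (M * phi t) `^ q) * ((2 * t) ^+ d * a) by rewrite exprMn; ring.
  rewrite ler_wpM2r ?mulr_ge0 ?(ltW a0) ?(ltW t20)//.
  rewrite -powRM ?(ltW D0)//; last by rewrite mulr_ge0 ?(ltW M0)// ltW.
  apply: ge0_ler_powR; rewrite ?nnegrE ?mulr_ge0 ?(ltW M0) ?(ltW D0) ?(ltW q0) ?(ltW phit) ?(ltW phi2t)//.
  rewrite mulrCA ler_wpM2l ?(ltW M0)//; apply: phi_dec => //; lra.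
apply: (poweR_le_inv P0 m0); first by rewrite lee_fin ltW.
have c0 : 0 < (t / d.+1%:R) ^+ d by rewrite exprn_gt0// divr_gt0.
have mP : (0 <= m `^ (p / q))%E by exact: poweR_ge0.
have XP : X `^ (p / q) * (t / d.+1%:R) ^+ d =
    (M * phi (2 * t)) `^ p * (((2 * t) ^+ d) `^ (p / q) * (2 * t) ^+ d).
  have aP : a `^ (p / q) = 2 ^+ d * d.+1%:R ^+ d.
    rewrite /a -powRrM (_ : q / p * (p / q) = 1) ?powRr1 ?mulr_ge0 ?exprn_ge0//.
    by field; rewrite !gt_eqF.
  rewrite /X powRM ?powR_ge0 ?mulr_ge0 ?(ltW a0) ?(ltW t20)//.
  rewrite (powRM _ (ltW t20) (ltW a0)) aP -powRrM (_ : q * (p / q) = p); last first.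
    by field; rewrite gt_eqF.
  rewrite -!mulrA; congr (_ * (_ * _)).
  by rewrite -!exprMn; congr (_ ^+ _); field.
have H : (m `^ (p / q) * ((t / d.+1%:R) ^+ d)%:E <=
    (X `^ (p / q) * (t / d.+1%:R) ^+ d)%:E)%E.
  have t2 : 0 < 2 * t by rewrite mulr_gt0.
  rewrite XP; apply: le_trans (gM _ t2).
  apply: (@le_trans _ _ (m `^ (p / q) * mu (eball x t))%E).
    by apply: lee_wpmul2l => //; exact: eball_measure_ge.
  rewrite -integral_cst//; last exact: measurable_eball.
  rewrite integral_mkcond; apply: le_integral_nonneg => y _.
    exact: erestrict_ge0.
  rewrite patchE; case: ifPn => [|_]; last exact: poweR_ge0.
  rewrite inE /eball /= => yx; apply: lee_poweR => //; first exact: ltW.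
  apply: le_ball_mass => // z xz _; split => //.
  by rewrite mulr_natl; exact: edist_lt_max yx xz.
by move: H; rewrite EFinM lee_pmul2r// lte_fin.
Qed.

End amalgam_bound.

Section integral_ball.
Variables (R : realType) (d : nat).
Local Notation mu := (lebesgueRd R d).

Lemma integral_eball_poweRD_le (u v : Rd R d -> \bar R) (s B r : R) y :
  0 <= s -> 0 <= B -> 0 < r -> measurable_fun setT u ->
  (forall x, (0 <= u x)%E) -> (forall x, (0 <= v x)%E) ->
  (forall x, eball y r x -> (v x <= B%:E)%E) ->
  (\int[mu]_(x in eball y r) ((u x + v x) `^ s) <=
   (2 `^ s)%:E * (\int[mu]_x (u x `^ s) + (B `^ s * (2 * r) ^+ d)%:E))%E.
Proof.
move=> s0 B0 r0 mu_ u0 v0 vB; have mball := measurable_eball y r.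
have mus : measurable_fun setT (fun x => u x `^ s)%E.
  exact: (measurableT_comp (measurable_poweR s)) mu_.
apply: (@le_trans _ _ (\int[mu]_(x in eball y r) ((2 `^ s)%:E *
    (u x `^ s + (B `^ s)%:E)))%E).
  apply: le_integral_nonneg => [x _|x yx]; first exact: poweR_ge0.
  apply: (le_trans (poweRD_le s0 (u0 x) (v0 x))).
  apply: lee_wpmul2l; first by rewrite lee_fin powR_ge0.
  by apply: leeD2l; rewrite -poweR_EFin; apply: lee_poweR => //; exact: vB.
rewrite ge0_integralZl_EFin ?powR_ge0//; last 2 first.
- by move=> x _; rewrite adde_ge0 ?poweR_ge0// lee_fin powR_ge0.
- by apply: emeasurable_funD => //; exact: measurable_funS mus.
rewrite ge0_integralD//; last 3 first.
- by move=> x _; exact: poweR_ge0.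
- exact: measurable_funS mus.
- by move=> x _; rewrite lee_fin powR_ge0.
rewrite integral_cst//; apply: lee_wpmul2l; first by rewrite lee_fin powR_ge0.
apply: leeD.
  by apply: ge0_subset_integral => // x _; exact: poweR_ge0.
rewrite EFinM; apply: lee_wpmul2l; first by rewrite lee_fin powR_ge0.
by rewrite mulr_natl; exact: eball_measure_le.
Qed.

End integral_ball.

(** * Potentials on a single ball *)

Section local_potential_bound.
Variables (R : realType) (d : nat) (k : Rd R d -> Rd R d -> R) (phi : R -> R).
Variables (e K q : R).
Local Notation mu := (lebesgueRd R d).
Implicit Types (x y z : Rd R d) (g h : Rd R d -> R).
Local Notation powf g q := (fun z => (g z `^ q)%R).

Hypotheses (k_ge0 : forall x z, 0 <= k x z) (kC : forall x z, k x z = k z x).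
Hypothesis mk : forall disp (T : measurableType disp) (f g : T -> Rd R d),
  measurable_fun setT f -> measurable_fun setT g ->
  measurable_fun setT (fun a => k (f a) (g a)).
Hypotheses (phi_surj : set_surj `]0, +oo[ `]0, +oo[ phi).
Hypotheses (e0 : 0 < e) (K0 : 0 <= K)
  (near : near_bound k phi e K) (far : far_bound k phi e K).
Hypothesis q1 : 1 < q.

Let q0 : 0 < q. Proof. exact: lt_trans q1. Qed.
Let qe0 : 0 < q / e. Proof. exact: divr_gt0. Qed.

(* The part of [g] in [B(y, 2r)] is handled by the strong type inequality, and
   the potential of the remaining part is bounded on [B(y, r)]. *)
Lemma potential_local_bound : exists2 C, 0 <= C & forall g (M c r : R) y,
  measurable_fun setT g -> (forall z, 0 <= g z) -> 0 < M -> 0 <= c -> 0 < r ->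
  (forall x t, 0 < t -> (ball_mass g x (2 * t) <= (t ^+ d * (M * phi t))%:E)%E) ->
  (forall t, r < 2 * t -> (ball_mass (powf g q) y (4 * t) <= (t ^+ d * c)%:E)%E) ->
  (\int[mu]_(x in eball y r) (potential k g x `^ (q / e)) <=
   (C * M `^ (q / e - q))%:E *
     (ball_mass (powf g q) y (2 * r) + (r ^+ d * c)%:E))%E.
Proof.
pose S := 2 `^ (q + 1) * (K * 4 ^+ d + K + 1) `^ (q / e) * (K * 4 ^+ d / (q - 1)).
pose V := (K * 2) `^ (q / e) * (4 ^+ d + 1) `^ q * 2 ^+ d.
have S0 : 0 <= S.
  by rewrite !mulr_ge0 ?powR_ge0 ?exprn_ge0// invr_ge0 subr_ge0 ltW.
have V0 : 0 <= V by rewrite !mulr_ge0 ?powR_ge0 ?exprn_ge0.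
exists (2 `^ (q / e) * (S + V)); first by rewrite mulr_ge0 ?powR_ge0// addr_ge0.
move=> g M c r y mg g0 M0 c0 r0 gM gc.
have rc0 : 0 <= r ^+ d * c by rewrite mulr_ge0// exprn_ge0// ltW.
pose b1 z := (edist y z < 2 * r)%R; pose b2 z := (2 * r <= edist y z)%R.
pose g1 z := g z * (b1 z)%:R; pose g2 z := g z * (b2 z)%:R.
have me : measurable_fun setT (fun z => edist y z) by exact: measurable_fun_edist.
have mg1 : measurable_fun setT g1.
  apply: measurable_funM => //; apply: measurable_fun_nat_of_bool.
  exact: measurable_fun_ltr.
have mg2 : measurable_fun setT g2.
  apply: measurable_funM => //; apply: measurable_fun_nat_of_bool.
  exact: measurable_fun_ler.
have g10 z : 0 <= g1 z by rewrite mulr_ge0 ?ler0n.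
have g20 z : 0 <= g2 z by rewrite mulr_ge0 ?ler0n.
have g1g z : g1 z <= g z by rewrite /g1; case: (b1 z); rewrite ?mulr1 ?mulr0.
have g2g z : g2 z <= g z by rewrite /g2; case: (b2 z); rewrite ?mulr1 ?mulr0.
have gq0 z : 0 <= g z `^ q by exact: powR_ge0.
have g2q0 z : 0 <= g2 z `^ q by exact: powR_ge0.
have g1M x t : 0 < t -> (ball_mass g1 x (2 * t) <= (t ^+ d * (M * phi t))%:E)%E.
  by move=> t0; apply: le_trans (gM x _ t0); exact: le_ball_mass.
have g2M x t : 0 < t -> (ball_mass g2 x (2 * t) <= (t ^+ d * (M * phi t))%:E)%E.
  by move=> t0; apply: le_trans (gM x _ t0); exact: le_ball_mass.
(* With [c = A^q], the bound [t^d * c] on [q]-masses becomes, by [ball_mass_young] with [b = 1], a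
   bound on averages by a multiple of [A]. *)
pose A := c `^ q^-1.
have A0 : 0 <= A by exact: powR_ge0.
have Aq : A `^ q = c by rewrite -powRrM mulVf ?gt_eqF// powRr1.
have g2A x t : eball y r x -> 0 < t ->
    (ball_mass g2 x (2 * t) <= (t ^+ d * ((4 ^+ d + 1) * A))%:E)%E.
  move=> xy t0; apply: (ball_mass_young q1) => //; rewrite Aq mul1r.
  have yx : edist y x < r by rewrite edistC.
  (* For [r < 2 t] the ball [B(x, 2t)] lies in [B(y, 4t)], where the hypothesis on [c] applies;
     otherwise it lies in [B(y, 2r)], where [g2] vanishes. *)
  have [rt|tr] := ltP r (2 * t).
    apply: le_trans (gc _ rt); apply: le_ball_mass => // z xz gz; split.
      rewrite (_ : 4 * t = 2 * t *+ 2); last by ring.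
      by apply: edist_lt_max xz; exact: lt_trans rt.
    by apply: ge0_ler_powR; rewrite ?nnegrE ?(ltW q0).
  apply: (@le_trans _ _ (ball_mass (cst 0) x (2 * t))).
    apply: le_ball_mass => // z xz; rewrite /g2 /b2 leNgt.
    have -> : (edist y z < 2 * r)%R.
      by rewrite mulr_natl; apply: edist_lt_max yx _; exact: lt_le_trans tr.
    by rewrite mulr0 powR0 ?gt_eqF ?ltxx.
  rewrite /ball_mass integral0_eq// lee_fin mulr_ge0// exprn_ge0// ltW//.
pose B := K * 2 * (((4 ^+ d + 1) * A) `^ e * M `^ (1 - e)).
have A40 : 0 <= (4 ^+ d + 1) * A by rewrite mulr_ge0// addr_ge0// exprn_ge0.
have pot2 x : eball y r x -> (potential k g2 x <= B%:E)%E.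
  move=> xy; apply: (@potential_le_interpolation R d k phi e K) => //.
  - by move=> t; exact: g2A.
  - by move=> t; exact: g2M.
have B0 : 0 <= B by rewrite !mulr_ge0 ?powR_ge0.
(* The power [q / e] turns [A^e] into [A^q = c] and [M^(1-e)] into [M^(q/e-q)]: the bound is linear
   in [c]. *)
have BE : B `^ (q / e) * 2 ^+ d = V * M `^ (q / e - q) * c.
  rewrite /B powRM ?mulr_ge0 ?powR_ge0//.
  rewrite [X in _ * X * _]powRM ?powR_ge0// -!powRrM.
  have -> : e * (q / e) = q by field; rewrite gt_eqF.
  have -> : (1 - e) * (q / e) = q / e - q by field; rewrite gt_eqF.
  rewrite [X in _ * (X * _) * _]powRM ?addr_ge0 ?exprn_ge0// Aq /V; ring.
have potD x : (potential k g x = potential k g1 x + potential k g2 x)%E.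
  rewrite /potential -ge0_integralD//.
  - apply: eq_integral => z _; rewrite -EFinD -mulrDr /g1 /g2 -mulrDr /b2 leNgt.
    by rewrite /b1; case: (_ < _)%R; rewrite ?addr0 ?add0r mulr1.
  - by move=> z _; rewrite lee_fin mulr_ge0.
  - by apply/measurable_EFinP; apply: measurable_funM => //; exact: mk.
  - by move=> z _; rewrite lee_fin mulr_ge0.
  - by apply/measurable_EFinP; apply: measurable_funM => //; exact: mk.
have int1 : (\int[mu]_z (g1 z `^ q)%:E = ball_mass (powf g q) y (2 * r))%E.
  rewrite ball_massE//; apply: eq_integral => z _; congr EFin; rewrite /g1 /b1.
  by case: (_ < _)%R; rewrite ?mulr1// !mulr0 powR0// gt_eqF.
have strong := potential_strong_type k_ge0 kC mk phi_surj e0 K0 near far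
  q1 mg1 g10 M0 g1M.
rewrite -/S int1 in strong.
have mpot : measurable_fun setT (potential k g1) by exact: measurable_potential.
have pot10 x : (0 <= potential k g1 x)%E by exact: potential_ge0.
have pot20 x : (0 <= potential k g2 x)%E by exact: potential_ge0.
under eq_integral do rewrite potD.
apply: le_trans (integral_eball_poweRD_le (ltW qe0) B0 r0 mpot pot10 pot20 pot2) _.
rewrite -[in leRHS]mulrA [in leRHS]EFinM -[leRHS]muleA.
apply: lee_wpmul2l; first by rewrite lee_fin powR_ge0.
have bm0 : (0 <= ball_mass (powf g q) y (2 * r))%E by exact: ball_mass_ge0.
have M0' : 0 <= M `^ (q / e - q) by exact: powR_ge0.
clear near far gM gc g1M g2M g2A pot2 potD mpot pot10 pot20.
rewrite ge0_muleDr//; apply: leeD.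
  apply: (le_trans strong); apply: lee_wpmul2r => //.
  by rewrite lee_fin ler_wpM2r// lerDl.
rewrite -!EFinM lee_fin exprMn mulrA BE.
rewrite -subr_ge0 (_ : _ - _ = S * M `^ (q / e - q) * (r ^+ d * c)); last by ring.
exact: mulr_ge0 (mulr_ge0 S0 M0') rc0.
Qed.

End local_potential_bound.

(** * The tail average over large radii *)

Section tail_average.
Variables (R : realType) (d : nat) (q p : R) (h : Rd R d -> R).
Local Notation mu := (lebesgueRd R d).
Local Notation leb := (@lebesgue_measure R).
Implicit Types (x y z : Rd R d) (r t s : R).
Hypotheses (q0 : 0 < q) (p0 : 0 < p).
Hypotheses (mh : measurable_fun setT h) (h0 : forall z, 0 <= h z).

Let P0 : 0 < p / q. Proof. exact: divr_gt0. Qed.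

Definition tail_weight r s : R :=
  (r < s)%R%:R * ((s ^+ d) `^ (- (p / q)) * s `^ (- 1)).

(** The integral of [(s^(-d) W(y, s))^(p/q) ds / s] over [s > r]. The power [p / q] is taken inside,
    so that after Tonelli the amalgam bound applies at each radius [s]. *)
Definition tail_average r y : \bar R :=
  \int[leb]_s (ball_mass h y s `^ (p / q) * (tail_weight r s)%:E).

Lemma tail_weight_ge0 r s : 0 <= tail_weight r s.
Proof. by rewrite mulr_ge0 ?ler0n// mulr_ge0 ?powR_ge0. Qed.

Let integrand_ge0 r y s :
  (0 <= ball_mass h y s `^ (p / q) * (tail_weight r s)%:E)%E.
Proof. by rewrite mule_ge0 ?poweR_ge0// lee_fin tail_weight_ge0. Qed.

Lemma tail_average_ge0 r y : (0 <= tail_average r y)%E.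
Proof. exact: integral_ge0. Qed.

Lemma measurable_tail_weight r :
  measurable_fun setT (tail_weight r : measurableTypeR R -> R).
Proof.
apply: measurable_funM.
  by apply: measurable_fun_nat_of_bool; exact: measurable_fun_ltr.
apply: measurable_funM; last exact: measurable_fun_powR_cst.
by apply: measurable_fun_powR_cst; apply: measurable_funX.
Qed.

Let measurable_integrand r : measurable_fun setT
  (fun a : Rd R d * measurableTypeR R =>
     ball_mass h a.1 a.2 `^ (p / q) * (tail_weight r a.2)%:E)%E.
Proof.
apply: emeasurable_funM.
  exact: (measurableT_comp (measurable_poweR _)) (measurable_ball_mass mh h0).
apply/measurable_EFinP.
exact: (measurableT_comp (measurable_tail_weight r) measurable_snd).
Qed.

Lemma measurable_tail_average r : measurable_fun setT (tail_average r).
Proof.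
apply: (@measurable_fun_fubini_tonelli_F _ _ _ _ _ leb
  (fun a : Rd R d * measurableTypeR R =>
     ball_mass h a.1 a.2 `^ (p / q) * (tail_weight r a.2)%:E)%E) => //.
Qed.

Lemma integral_tail_average r :
  (\int[mu]_y tail_average r y =
   \int[leb]_s ((\int[mu]_y (ball_mass h y s `^ (p / q))) * (tail_weight r s)%:E))%E.
Proof.
rewrite (@fubini_tonelli _ _ _ _ _ mu leb (fun a : Rd R d * measurableTypeR R =>
     ball_mass h a.1 a.2 `^ (p / q) * (tail_weight r a.2)%:E)%E)//.
apply: eq_integral => s _ /=; rewrite ge0_integralZr//.
- apply: (measurableT_comp (measurable_poweR _)).
  exact: measurable_ball_mass1.
- by move=> y _; exact: poweR_ge0.
- by rewrite lee_fin tail_weight_ge0.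
Qed.

(* The radii in [(4 t, 8 t)] already give this much. *)
Lemma ball_mass_le_tail_average r y t : 0 < r -> r < 2 * t ->
  (ball_mass h y (4 * t) <=
   ((8 * t) ^+ d)%:E * (2%:E * tail_average r y) `^ (q / p))%E.
Proof.
move=> r0 rt; have t0 : 0 < t by nra.
have t8 : 0 < 8 * t by rewrite mulr_gt0.
have td : 0 < (8 * t) ^+ d by rewrite exprn_gt0.
have E0 := tail_average_ge0 r y.
have E20 : (0 <= 2%:E * tail_average r y)%E by rewrite mule_ge0.
have m0 := ball_mass_ge0 y (4 * t) h0.
set m := ball_mass h y (4 * t) in m0 *.
have mP0 : (0 <= m `^ (p / q))%E by exact: poweR_ge0.
apply: (poweR_le_inv P0) => //.
  by rewrite mule_ge0 ?poweR_ge0// lee_fin ltW.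
rewrite poweRM ?poweR_ge0 ?lee_fin ?(ltW td)// -poweRrM.
rewrite (_ : q / p * (p / q) = 1) ?poweRe1//; last first.
  by field; rewrite !gt_eqF.
(* The value of the weight at [8 t], hence its minimum on [(4 t, 8 t)]. Times the length [4 t] it is
   half of [(8 t)^(-d p / q)], which explains the factor [2] in front of the tail average. *)
pose w := ((8 * t) ^+ d) `^ (- (p / q)) * (8 * t) `^ (- 1).
have w0 : 0 <= w by rewrite mulr_ge0 ?powR_ge0.
have : (m `^ (p / q) * (w * (4 * t))%:E <= tail_average r y)%E.
  rewrite EFinM muleA.
  have -> : (4 * t)%:E = leb `](4 * t), (8 * t)[%classic.
    rewrite lebesgue_measure_itv/= lte_fin ifT; last by lra.
    by rewrite -EFinD; congr EFin; ring.
  rewrite -integral_cst; last exact: measurable_itv.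
  rewrite integral_mkcond; apply: le_integral_nonneg => s _.
    by apply: erestrict_ge0 => ? _; rewrite mule_ge0// lee_fin.
  rewrite patchE; case: ifPn => [|_]; last exact: integrand_ge0.
  rewrite inE /= in_itv/= => /andP[ts st].
  have s0 : 0 < s by nra.
  apply: lee_pmul => //.
    by apply: lee_poweR => //; [exact: ltW|apply: le_ball_mass => // z ? _; split => //; lra].
  rewrite lee_fin /tail_weight (_ : (r < s)%R); last by nra.
  rewrite mul1r; apply: ler_pM; rewrite ?powR_ge0// !powRN lef_pV2 ?posrE ?powR_gt0 ?exprn_gt0//.
    apply: ge0_ler_powR; rewrite ?nnegrE ?exprn_ge0 ?(ltW s0) ?(ltW t8) ?(ltW P0)//.
    by apply: lerXn2r; rewrite ?nnegrE ?(ltW s0) ?(ltW t8)// ltW.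
  by rewrite !powRr1 ?(ltW s0) ?(ltW t8)// ltW.
have wE : w * (4 * t) = (2 * ((8 * t) ^+ d) `^ (p / q))^-1.
  rewrite /w !powRN powRr1 ?(ltW t8)//; field.
  by rewrite !gt_eqF ?powR_gt0.
rewrite wE => H.
have c0 : 0 < 2 * ((8 * t) ^+ d) `^ (p / q) by rewrite mulr_gt0 ?powR_gt0.
move: H; rewrite lee_pdivrMr// => /le_trans; apply.
by rewrite poweR_EFin EFinM [leLHS]muleCA [leRHS]muleCA (muleC (tail_average r y)).
Qed.

End tail_average.

(** * Integrating the local bounds over all centres *)

Section global_potential_bound.
Variables (R : realType) (d : nat) (k : Rd R d -> Rd R d -> R) (phi : R -> R).
Variables (e K q p D T : R).
Local Notation mu := (lebesgueRd R d).
Local Notation leb := (@lebesgue_measure R).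
Implicit Types (x y z : Rd R d) (g h : Rd R d -> R) (M r s t : R).
Local Notation powf g q := (fun z => (g z `^ q)%R).

Hypotheses (q1 : 1 < q) (qp : q <= p) (D0 : 0 < D) (T0 : 0 <= T).
Hypothesis phi_gt0 : forall t, 0 < t -> 0 < phi t.
Hypothesis phi_dec : forall s t, 0 < s -> s <= t -> phi t <= D * phi s.
Hypothesis phi_tail : forall r, 0 < r ->
  (\int[leb]_(s in `]r, +oo[) (phi s `^ p * s ^+ d / s)%:E
    <= (T * (phi r `^ p * r ^+ d))%:E)%E.
Hypotheses (k_ge0 : forall x z, 0 <= k x z) (kC : forall x z, k x z = k z x).
Hypothesis mk : forall disp (T : measurableType disp) (f g : T -> Rd R d),
  measurable_fun setT f -> measurable_fun setT g ->
  measurable_fun setT (fun a => k (f a) (g a)).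
Hypotheses (phi_surj : set_surj `]0, +oo[ `]0, +oo[ phi).
Hypotheses (e0 : 0 < e) (K0 : 0 <= K)
  (near : near_bound k phi e K) (far : far_bound k phi e K).

Let q0 : 0 < q. Proof. exact: lt_trans q1. Qed.
Let p0 : 0 < p. Proof. exact: lt_le_trans qp. Qed.
Let P0 : 0 < p / q. Proof. exact: divr_gt0. Qed.

(** Passes from [q]-masses to averages of [g] by [ball_mass_young] with [a = M * phi t]; the radius
    [2 t] costs [2^d] for the volume and [D^q] for [phi (2 t) <= D * phi t]. *)
Lemma ball_mass1_le_amalgam : exists2 b, 0 < b & forall g M x t,
  measurable_fun setT g -> (forall z, 0 <= g z) -> 0 < M ->
  amalgam_bound q p phi g M -> 0 < t ->
  (ball_mass g x (2 * t) <= (t ^+ d * (b * M * phi t))%:E)%E.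
Proof.
have [b b0 H] := ball_mass_le_amalgam d q1 qp D0 phi_gt0 phi_dec.
have b20 : 0 <= 2 ^+ d * b * D `^ q.
  by rewrite !mulr_ge0 ?powR_ge0 ?exprn_ge0// ltW.
exists (4 ^+ d + 2 ^+ d * b * D `^ q).
  by rewrite ltr_pwDl// exprn_gt0.
move=> g M x t mg g0 M0 gM t0; have pt := phi_gt0 t0.
have t20 : 0 < 2 * t by rewrite mulr_gt0.
have p2t := phi_gt0 t20.
rewrite -(mulrA _ M); apply: (ball_mass_young q1) => //.
  by rewrite mulr_ge0 ?(ltW M0)// ltW.
apply: (le_trans (H g M x (2 * t) mg g0 M0 gM t20)); rewrite lee_fin.
rewrite exprMn (_ : _ * _ * (b * _) = (t ^+ d * (2 ^+ d * b)) * (M * phi (2 * t)) `^ q); last by ring.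
rewrite -(mulrA _ (D `^ q)) mulrA; apply: ler_wpM2l.
  by rewrite !mulr_ge0 ?exprn_ge0// ltW.
have DM : 0 <= M * phi t by rewrite mulr_ge0 ?(ltW M0)// ltW.
rewrite -powRM ?(ltW D0)//; apply: ge0_ler_powR; rewrite ?nnegrE ?mulr_ge0 ?(ltW M0) ?(ltW D0) ?(ltW q0) ?(ltW pt) ?(ltW p2t)//.
by rewrite mulrCA ler_wpM2l ?(ltW M0)//; apply: phi_dec => //; lra.
Qed.

(** The weight cancels the factor [(s^d)^(p/q)] of the amalgam bound, and [M^p * phi^p * s^d / s]
    remains, to be integrated by [phi_tail]. *)
Lemma integral_tail_average_le g M r : measurable_fun setT g ->
  0 < M -> 0 < r -> amalgam_bound q p phi g M ->
  (\int[mu]_y tail_average q p (powf g q) r y <=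
    (M `^ p * (T * (phi r `^ p * r ^+ d)))%:E)%E.
Proof.
move=> mg M0 r0 gM.
rewrite integral_tail_average//; last 2 first.
- exact: measurable_fun_powR_cst.
- by move=> z; exact: powR_ge0.
apply: (@le_trans _ _ (\int[leb]_(s in `]r, +oo[)
    ((M `^ p)%:E * (phi s `^ p * s ^+ d / s)%:E))%E).
  rewrite [leRHS]integral_mkcond; apply: le_integral_nonneg => s _.
    rewrite mule_ge0 ?lee_fin ?tail_weight_ge0//.
    by apply: integral_ge0 => y _; exact: poweR_ge0.
  rewrite patchE mem_setE in_itv/= andbT /tail_weight.
  have [rs|_] := ltP r s; last by rewrite mul0r mule0.
  have s0 : 0 < s by exact: lt_trans rs.
  have sd : 0 < s ^+ d by rewrite exprn_gt0.
  have ps := phi_gt0 s0.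
  rewrite mul1r; have w0 : 0 <= (s ^+ d) `^ (- (p / q)) * s `^ (-1).
    by rewrite mulr_ge0 ?powR_ge0.
  apply: (@le_trans _ _ (((M * phi s) `^ p * ((s ^+ d) `^ (p / q) * s ^+ d))%:E *
      ((s ^+ d) `^ (- (p / q)) * s `^ (-1))%:E)%E).
    by apply: lee_wpmul2r (gM _ s0); rewrite lee_fin.
  rewrite -!EFinM lee_fin powRM ?(ltW M0) ?(ltW ps)// !powRN powRr1 ?(ltW s0)//.
  rewrite le_eqVlt; apply/orP; left; apply/eqP; field.
  by rewrite !gt_eqF// powR_gt0.
apply: (le_trans (integralZl_le_nonneg _ _ _)) => //.
- by rewrite powR_gt0.
- move=> s /=; rewrite in_itv/= andbT => rs; have s0 := lt_trans r0 rs.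
  by rewrite lee_fin mulr_ge0 ?invr_ge0 ?(ltW s0)// mulr_ge0 ?powR_ge0// exprn_ge0// ltW.
by rewrite EFinM; apply: lee_wpmul2l (phi_tail r0); rewrite lee_fin powR_ge0.
Qed.

(** [potential_local_bound] with a [c] that depends on the centre, namely
    [8^d * (2 * tail_average)^(q/p)] at [y]. *)
Lemma potential_tail_bound : exists2 C, 0 < C & forall g M r y,
  measurable_fun setT g -> (forall z, 0 <= g z) -> 0 < M -> 0 < r ->
  amalgam_bound q p phi g M ->
  (\int[mu]_(x in eball y r) (potential k g x `^ (q / e)) <=
   (C * M `^ (q / e - q))%:E * (ball_mass (powf g q) y (2 * r) +
     ((8 * r) ^+ d)%:E * (2%:E * tail_average q p (powf g q) r y) `^ (q / p)))%E.
Proof.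
have [C C0 HC] := potential_local_bound k_ge0 kC mk phi_surj e0 K0 near far q1.
have [b b0 Hb] := ball_mass1_le_amalgam.
clear near far.
(* [C] may be [0]; with [C + 1] the right-hand side is infinite whenever the tail average is, a case
   in which no real [c] is available. *)
exists ((C + 1) * b `^ (q / e - q)).
  by rewrite mulr_gt0 ?powR_gt0// ltr_wpDl.
move=> g M r y mg g0 M0 r0 gM.
have mgq : measurable_fun setT (powf g q) by exact: measurable_fun_powR_cst.
have gq0 z : 0 <= g z `^ q by exact: powR_ge0.
have W0 := ball_mass_ge0 y (2 * r) gq0.
have E0 := tail_average_ge0 q p (powf g q) r y.
have c0 : 0 < (C + 1) * b `^ (q / e - q) * M `^ (q / e - q).
  by rewrite !mulr_gt0 ?powR_gt0// ltr_wpDl.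
have r8 : 0 < (8 * r) ^+ d by rewrite exprn_gt0// mulr_gt0.
have qp0 : q / p != 0 by rewrite mulf_neq0 ?invr_eq0 ?gt_eqF.
have [Ey|] := eqVneq (tail_average q p (powf g q) r y) +oo%E.
  rewrite Ey gt0_muley ?lte_fin// poweRyr// gt0_muley ?lte_fin//.
  rewrite addey; last by rewrite gt_eqF// (lt_le_trans _ W0).
  by rewrite gt0_muley ?lte_fin// leey.
rewrite -ltey -ge0_fin_numE// => Efin.
have hE t : r < 2 * t -> (ball_mass (powf g q) y (4 * t) <=
    (t ^+ d * (8 ^+ d * (2 * fine (tail_average q p (powf g q) r y)) `^ (q / p)))%:E)%E.
  move=> rt; apply: (le_trans (ball_mass_le_tail_average q0 p0 gq0 y r0 rt)).
  by rewrite -[in leLHS](fineK Efin) -(EFinM 2) poweR_EFin -EFinM lee_fin exprMn mulrA (mulrC (8 ^+ d)).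
have c80 : 0 <= 8 ^+ d * (2 * fine (tail_average q p (powf g q) r y)) `^ (q / p).
  by rewrite mulr_ge0 ?powR_ge0// exprn_ge0.
have bM0 : 0 < b * M by rewrite mulr_gt0.
have gbM x t (t0 : 0 < t) := Hb g M x t mg g0 M0 gM t0.
apply: (le_trans (HC g (b * M) _ r y mg g0 bM0 c80 r0 gbM hE)).
rewrite -[in leRHS](fineK Efin) -(EFinM 2) poweR_EFin -EFinM exprMn.
rewrite (_ : 8 ^+ d * r ^+ d * _ = r ^+ d * (8 ^+ d *
  (2 * fine (tail_average q p (powf g q) r y)) `^ (q / p))); last by ring.
apply: lee_wpmul2r.
  by rewrite adde_ge0// lee_fin mulr_ge0// exprn_ge0// ltW.
rewrite lee_fin powRM ?(ltW b0) ?(ltW M0)// mulrA ler_wpM2r ?powR_ge0//.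
by rewrite ler_wpM2r ?powR_ge0// lerDl.
Qed.

(** Raised to the power [p / q], the right-hand side of [potential_tail_bound] becomes linear in
    [W(y, 2r)^(p/q)] and in the tail average, and both have known integrals in [y]. *)
Lemma potential_global_bound : exists2 C, 0 < C & forall g M r,
  measurable_fun setT g -> (forall z, 0 <= g z) -> 0 < M -> 0 < r ->
  amalgam_bound q p phi g M ->
  (\int[mu]_y ((\int[mu]_(x in eball y r) (potential k g x `^ (q / e))) `^ (p / q)) <=
   (C * M `^ (p / e) * phi r `^ p * ((r ^+ d) `^ (p / q) * r ^+ d))%:E)%E.
Proof.
have [C C0 HC] := potential_tail_bound.
clear near far.
(* The first summand comes from the amalgam bound at radius [2 r], with [phi (2 r) <= D * phi r];
   the second from the tail average. *)
pose V := D `^ p * ((2 ^+ d) `^ (p / q) * 2 ^+ d) + (8 ^+ d) `^ (p / q) * 2 * T.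
have V0 : 0 < V.
  rewrite ltr_pwDl ?mulr_gt0 ?powR_gt0 ?exprn_gt0//.
  by rewrite !mulr_ge0 ?powR_ge0.
exists ((C * 2) `^ (p / q) * V).
  by rewrite mulr_gt0// powR_gt0// mulr_gt0.
move=> g M r mg g0 M0 r0 gM.
have mgq : measurable_fun setT (powf g q) by exact: measurable_fun_powR_cst.
have gq0 z : 0 <= g z `^ q by exact: powR_ge0.
have W0 y : (0 <= ball_mass (powf g q) y (2 * r))%E by exact: ball_mass_ge0.
pose E := tail_average q p (powf g q) r.
have E0 y : (0 <= E y)%E by exact: tail_average_ge0.
have mE : measurable_fun setT E by exact: measurable_tail_average.
have r20 : 0 < 2 * r by rewrite mulr_gt0.
have rd : 0 < r ^+ d by rewrite exprn_gt0.
have r8 : 0 < (8 * r) ^+ d by rewrite exprn_gt0// mulr_gt0.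
pose c := C * M `^ (q / e - q).
have c0 : 0 < c by rewrite mulr_gt0// powR_gt0.
pose a := ((8 * r) ^+ d) `^ (p / q) * 2.
have a0 : 0 <= a by rewrite mulr_ge0// powR_ge0.
have ptw y : ((\int[mu]_(x in eball y r) (potential k g x `^ (q / e))) `^ (p / q) <=
    ((c * 2) `^ (p / q))%:E *
      (ball_mass (powf g q) y (2 * r) `^ (p / q) + a%:E * E y))%E.
  have E20 : (0 <= 2%:E * E y)%E by rewrite mule_ge0.
  have s0 : (0 <= ((8 * r) ^+ d)%:E * (2%:E * E y) `^ (q / p))%E.
    by rewrite mule_ge0 ?poweR_ge0// lee_fin ltW.
  have J0 : (0 <= \int[mu]_(x in eball y r) (potential k g x `^ (q / e)))%E.
    by apply: integral_ge0 => x _; exact: poweR_ge0.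
  apply: (le_trans (lee_poweR (ltW P0) J0 (HC g M r y mg g0 M0 r0 gM))).
  have c0' : (0 <= c%:E)%E by rewrite lee_fin ltW.
  have r8' : (0 <= ((8 * r) ^+ d)%:E)%E by rewrite lee_fin ltW.
  rewrite -/c -/(E y) (poweRM _ c0' (adde_ge0 (W0 y) s0)) poweR_EFin.
  rewrite (powRM _ (ltW c0) (ler0n _ 2)) EFinM -muleA; apply: lee_wpmul2l.
    by rewrite lee_fin powR_ge0.
  apply: (le_trans (poweRD_le (ltW P0) (W0 y) s0)).
  apply: lee_wpmul2l; first by rewrite lee_fin powR_ge0.
  rewrite (poweRM _ r8' (poweR_ge0 _ _)) -poweRrM.
  rewrite (_ : q / p * (p / q) = 1) ?poweRe1//; last first.
    by field; rewrite !gt_eqF.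
  by rewrite poweR_EFin muleA -EFinM.
apply: (le_trans (le_integral_nonneg mu (fun y _ => poweR_ge0 _ _) (fun y _ => ptw y))).
have mW : measurable_fun setT (fun y => ball_mass (powf g q) y (2 * r) `^ (p / q))%E.
  exact: (measurableT_comp (measurable_poweR _)) (measurable_ball_mass1 _ mgq gq0).
have aE0 y : (0 <= a%:E * E y)%E by rewrite mule_ge0.
have maE : measurable_fun setT (fun y => a%:E * E y)%E by exact: measurable_funeM.
rewrite ge0_integralZl_EFin ?powR_ge0//; last 2 first.
- by move=> y _; rewrite adde_ge0// poweR_ge0.
- exact: emeasurable_funD.
rewrite ge0_integralD//; last by move=> y _; exact: poweR_ge0.
rewrite ge0_integralZl_EFin//.
have p2r := phi_gt0 r20; have pr := phi_gt0 r0.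
have h1 := gM _ r20.
have h2 := lee_wpmul2l (_ : 0 <= a%:E)%E (integral_tail_average_le mg M0 r0 gM).
have {}h2 := h2 a0.
apply: (@le_trans _ _ (((c * 2) `^ (p / q))%:E *
   (((M * phi (2 * r)) `^ p * (((2 * r) ^+ d) `^ (p / q) * (2 * r) ^+ d))%:E +
    a%:E * (M `^ p * (T * (phi r `^ p * r ^+ d)))%:E))%E).
  by apply: lee_wpmul2l; [rewrite lee_fin powR_ge0|exact: leeD].
rewrite -(EFinM a) -EFinD -EFinM lee_fin.
(* The exponents of [M] add up: [(q/e - q) * (p/q) + p = p/e]. *)
have cE : (c * 2) `^ (p / q) * M `^ p = (C * 2) `^ (p / q) * M `^ (p / e).
  rewrite /c mulrAC powRM ?powR_ge0 ?mulr_ge0 ?(ltW C0)// -powRrM -mulrA.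
  rewrite -powRD ?(gt_eqF M0) ?implybT//; congr (_ * _ `^ _).
  by field; rewrite !gt_eqF.
have D1 : phi (2 * r) `^ p <= D `^ p * phi r `^ p.
  rewrite -powRM ?(ltW D0) ?(ltW pr)//; apply: ge0_ler_powR.
  - exact: ltW.
  - by rewrite nnegrE ltW.
  - by rewrite nnegrE mulr_ge0// ltW.
  by apply: phi_dec => //; lra.
rewrite powRM ?(ltW M0) ?(ltW p2r)// /a !exprMn !(powRM _ (_ : 0 <= _ ^+ d) (ltW rd)) ?exprn_ge0//.
rewrite [leRHS](_ : _ = (c * 2) `^ (p / q) * M `^ p *
  ((D `^ p * phi r `^ p) * ((2 ^+ d) `^ (p / q) * (r ^+ d) `^ (p / q) * (2 ^+ d * r ^+ d)) +
   (8 ^+ d) `^ (p / q) * (r ^+ d) `^ (p / q) * 2 * (T * (phi r `^ p * r ^+ d)))); last first.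
  by rewrite cE /V; ring.
rewrite -[leRHS]mulrA; apply: ler_wpM2l; first exact: powR_ge0.
rewrite [leRHS]mulrDr; apply: lerD; last by rewrite le_eqVlt; apply/orP; left; apply/eqP; ring.
rewrite -(mulrA (M `^ p)); apply: ler_wpM2l; first exact: powR_ge0.
by apply: ler_wpM2r D1; rewrite !mulr_ge0 ?powR_ge0 ?exprn_ge0// ltW.
Qed.

(** A power of the potential is integrable on each ball around the origin, and these balls exhaust
    the space. The constant [c] of [potential_local_bound] comes from the pointwise mass bound: for
    [r < 2 t], [phi (4 t) <= D * phi r] makes it independent of [t]. *)
Lemma potential_ae_finite g M : measurable_fun setT g -> (forall z, 0 <= g z) ->
  0 < M -> amalgam_bound q p phi g M ->
  {ae mu, forall x, (potential k g x < +oo)%E}.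
Proof.
have [C C0 HC] := potential_local_bound k_ge0 kC mk phi_surj e0 K0 near far q1.
have [b b0 Hb] := ball_mass1_le_amalgam.
have [b' b'0 Hb'] := ball_mass_le_amalgam d q1 qp D0 phi_gt0 phi_dec.
clear near far => mg g0 M0 gM.
have qe0 : 0 < q / e by rewrite divr_gt0.
have gq0 z : 0 <= g z `^ q by exact: powR_ge0.
have bM0 : 0 < b * M by rewrite mulr_gt0.
have gbM x t (t0 : 0 < t) := Hb g M x t mg g0 M0 gM t0.
pose o : Rd R d := [tuple of nseq d 0].
have mpot : measurable_fun setT (fun x => potential k g x `^ (q / e))%E.
  apply: (measurableT_comp (measurable_poweR _)); exact: measurable_potential.
have fin_ball r : 0 < r ->
    (\int[mu]_(x in eball o r) (potential k g x `^ (q / e)) < +oo)%E.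
  move=> r0; have pr := phi_gt0 r0.
  pose c := 4 ^+ d * (b' * (M * (D * phi r)) `^ q).
  have c0 : 0 <= c.
    by rewrite mulr_ge0 ?exprn_ge0// mulr_ge0 ?powR_ge0// ltW.
  have hc t : r < 2 * t -> (ball_mass (powf g q) o (4 * t) <= (t ^+ d * c)%:E)%E.
    move=> rt; have t0 : 0 < 4 * t by lra.
    have t1 : 0 < t by lra.
    have pt := phi_gt0 t0.
    apply: (le_trans (Hb' g M o (4 * t) mg g0 M0 gM t0)); rewrite lee_fin.
    rewrite exprMn (_ : t ^+ d * c =
      4 ^+ d * t ^+ d * b' * (M * (D * phi r)) `^ q); last by rewrite /c; ring.
    rewrite [leLHS]mulrA; apply: ler_wpM2l.
      by rewrite !mulr_ge0 ?exprn_ge0// ltW.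
    apply: ge0_ler_powR; rewrite ?nnegrE ?mulr_ge0 ?(ltW M0) ?(ltW D0) ?(ltW q0) ?(ltW pt) ?(ltW pr)//.
    by rewrite ler_wpM2l ?(ltW M0)//; apply: phi_dec => //; lra.
  apply: (le_lt_trans (HC g (b * M) c r o mg g0 bM0 c0 r0 gbM hc)).
  have W : (ball_mass (powf g q) o (2 * r) < +oo)%E.
    have r20 : 0 < 2 * r by rewrite mulr_gt0.
    by apply: (le_lt_trans (Hb' g M o (2 * r) mg g0 M0 gM r20)); rewrite ltry.
  by apply: lte_mul_pinfty; rewrite ?lee_fin ?mulr_ge0 ?powR_ge0// lte_add_pinfty// ltry.
have : mu.-negligible (\bigcup_n (eball o n.+1%:R `&` [set x | ~ (potential k g x < +oo)%E])).
  apply: negligible_bigcup => n.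
  have n0 : 0 < n.+1%:R :> R by [].
  have mball := measurable_eball o n.+1%:R.
  have : mu.-integrable (eball o n.+1%:R) (fun x => potential k g x `^ (q / e))%E.
    apply/integrableP; split; first exact: measurable_funS mpot.
    under eq_integral do rewrite gee0_abs ?poweR_ge0//.
    exact: fin_ball.
  move=> /(integrable_ae mball) [N [mN N0 NS]]; exists N; split => // x [xb /= pinf].
  apply: NS => /= /(_ xb); rewrite ge0_fin_numE ?poweR_ge0// => /lty_poweRy.
  by rewrite gt_eqF// => /(_ isT).
apply: negligibleS => x /= xinf; exists (Num.truncn (edist x o)) => //; split => //.
exact: truncnS_gt.
Qed.

End global_potential_bound.

(** * Consequences of the hypotheses on [phi] and [rho] *)

Section growth_function.
Variables (R : realType) (d : nat) (q p D : R) (phi : R -> R).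
Local Notation leb := (@lebesgue_measure R).
Hypotheses (q0 : 0 < q) (qp : q <= p) (D0 : 0 < D).
Hypothesis phi_gt0 : forall t, 0 < t -> 0 < phi t.
Hypothesis phi_dec : forall s t, 0 < s -> s <= t ->
  phi t * t `^ (d%:R / p) <= D * (phi s * s `^ (d%:R / p)).

Let p0 : 0 < p. Proof. exact: lt_le_trans qp. Qed.

Lemma almost_decreasing_of_weighted s t : 0 < s -> s <= t -> phi t <= D * phi s.
Proof.
move=> s0 st; have t0 : 0 < t by exact: lt_le_trans st.
have sp : 0 < s `^ (d%:R / p) by rewrite powR_gt0.
rewrite -(ler_pM2r sp) -mulrA; apply: le_trans (phi_dec s0 st).
apply: ler_wpM2l; first exact/ltW/phi_gt0.
by apply: ge0_ler_powR; rewrite ?nnegrE ?divr_ge0 ?(ltW s0) ?(ltW t0) ?(ltW p0).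
Qed.

(* The extra factor [phi^(p - q) t^(d - d q / p)] is a power of the almost
   decreasing function [phi t^(d / p)]. *)
Lemma growth_function_tail C : 0 <= C ->
  (forall r, 0 < r ->
    (\int[leb]_(t in `]r, +oo[) (phi t `^ q * t `^ (d%:R * q / p - 1))%:E
       <= (C * (phi r `^ q * r `^ (d%:R * q / p)))%:E)%E) ->
  forall r, 0 < r -> (\int[leb]_(s in `]r, +oo[) (phi s `^ p * s ^+ d / s)%:E
    <= (D `^ (p - q) * C * (phi r `^ p * r ^+ d))%:E)%E.
Proof.
move=> C0 HC r r0; have pr := phi_gt0 r0.
have split s : 0 < s -> phi s `^ p * s ^+ d =
    (phi s * s `^ (d%:R / p)) `^ (p - q) * (phi s `^ q * s `^ (d%:R * q / p)).
  move=> s0; have ps := phi_gt0 s0.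
  rewrite powRM ?powR_ge0 ?(ltW ps)// mulrACA -powRD ?(gt_eqF ps) ?implybT//.
  rewrite subrK -powRrM -powRD ?(gt_eqF s0) ?implybT//.
  rewrite (_ : d%:R / p * (p - q) + d%:R * q / p = d%:R).
    by rewrite powR_mulrn ?(ltW s0).
  by field; rewrite gt_eqF.
pose c := (D * (phi r * r `^ (d%:R / p))) `^ (p - q).
have c0 : 0 < c by rewrite powR_gt0// mulr_gt0// mulr_gt0// powR_gt0.
apply: (@le_trans _ _ (\int[leb]_(s in `]r, +oo[)
    (c%:E * (phi s `^ q * s `^ (d%:R * q / p - 1))%:E))%E).
  apply: le_integral_nonneg => s /=; rewrite in_itv/= andbT => rs.
    have s0 : 0 < s by exact: lt_trans rs.
    by rewrite lee_fin !mulr_ge0 ?powR_ge0 ?exprn_ge0 ?invr_ge0// ltW.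
  have s0 : 0 < s by exact: lt_trans rs.
  have -> : s `^ (d%:R * q / p - 1) = s `^ (d%:R * q / p) / s.
    by rewrite powRD ?(gt_eqF s0) ?implybT// powR_inv1 ?(ltW s0).
  rewrite -EFinM lee_fin split// [in leRHS]mulrA [leRHS]mulrA; apply: ler_wpM2r.
    by rewrite invr_ge0 ltW.
  apply: ler_wpM2r; first by rewrite mulr_ge0 ?powR_ge0.
  apply: ge0_ler_powR; rewrite ?nnegrE ?subr_ge0//.
  - by rewrite mulr_ge0 ?powR_ge0// ltW// phi_gt0.
  - by rewrite !mulr_ge0 ?powR_ge0// ltW.
  - by apply: phi_dec => //; exact: ltW.
apply: (le_trans (integralZl_le_nonneg _ _ _)) => //.
  by move=> s _; rewrite lee_fin mulr_ge0 ?powR_ge0.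
apply: (@le_trans _ _ (c%:E * (C * (phi r `^ q * r `^ (d%:R * q / p)))%:E)%E).
  by apply: lee_wpmul2l (HC r r0); rewrite lee_fin ltW.
rewrite -EFinM lee_fin split// /c (powRM _ (ltW D0)); last first.
  by rewrite mulr_ge0 ?powR_ge0// ltW.
by rewrite le_eqVlt; apply/orP; left; apply/eqP; ring.
Qed.

End growth_function.

Section doubling_function.
Variable R : realType.
Local Notation leb := (@lebesgue_measure R).

(** [rho0] is [rho] set to [0] on a null set. Lowering the function keeps the integral conditions,
    and keeps the upper half of doubling as long as the reference point [t] avoids [N]. *)
Lemma doubling_measurable (rho : R -> R) : pos_valued rho -> doubling rho ->
  completed_measurable_fun leb `]0, +oo[ rho ->
  exists (rho0 : R -> R) (N : set (measurableTypeR R)),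
    [/\ measurable_fun [set: measurableTypeR R] rho0, measurable N, leb N = 0%E,
        (forall t, 0 <= rho0 t) &
    [/\ forall t, 0 < t -> rho0 t <= rho t,
        forall t, 0 < t -> ~ N t -> rho0 t = rho t &
        exists2 C, 0 < C & forall u t, 0 < u -> 0 < t -> ~ N t ->
          2^-1 <= u / t <= 2 -> rho0 u <= C * rho0 t]].
Proof.
move=> rho_gt0 [C C0 rhoC] mrho.
pose D : set (measurableTypeR R) := `]0, +oo[%classic.
have mD : measurable D by exact: measurable_itv.
have [N [mN N0 mrhoN]] := completed_measurable_fun_off_null mD mrho.
have Dgt t : D t = (0 < t) :> Prop by rewrite /D /= in_itv/= andbT.
have rho0E t : 0 < t -> ~ N t -> (rho \_ (D `\` N)) t = rho t.
  by move=> t0 nNt; rewrite patchE mem_set//; split => //; rewrite Dgt.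
have rho0_le t : 0 < t -> (rho \_ (D `\` N)) t <= rho t.
  by move=> t0; rewrite patchE; case: ifPn => // _; exact/ltW/rho_gt0.
exists (rho \_ (D `\` N)), N; split => //.
- by apply/(measurable_restrictT _ _).1 => //; exact: measurableD.
- move=> t; rewrite patchE; case: ifPn => //; rewrite inE => -[+ _].
  by rewrite Dgt => /rho_gt0/ltW.
split => //; exists C => // u t u0 t0 nNt ut; rewrite (rho0E t)//.
apply: (le_trans (rho0_le _ u0)); have /andP[_] := rhoC _ _ u0 t0 ut.
by rewrite ler_pdivrMr// rho_gt0.
Qed.

End doubling_function.

Section kernel_bounds.
Variables (R : realType) (d : nat).
Implicit Types (k : Rd R d -> Rd R d -> R) (phi : R -> R).

Lemma near_bound_le k phi e (K K' : R) : K <= K' -> near_bound k phi e K ->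
  near_bound k phi e K'.
Proof.
move=> KK' H x h m s mh h0 m0 s0 hm; apply: (le_trans (H x h m s mh h0 m0 s0 hm)).
by rewrite lee_fin ler_wpM2r ?powR_ge0// ler_wpM2r.
Qed.

Lemma far_bound_le k phi e (K K' : R) : K <= K' -> far_bound k phi e K ->
  far_bound k phi e K'.
Proof.
move=> KK' H x h m s mh h0 m0 s0 hm; apply: (le_trans (H x h m s mh h0 m0 s0 hm)).
by rewrite lee_fin ler_wpM2r ?powR_ge0// ler_wpM2r.
Qed.

End kernel_bounds.

(** * Fofana norms and amalgam bounds *)

Section amalgam_norms.
Variables (R : realType) (d : nat).
Local Notation mu := (lebesgueRd R d).
Implicit Types (f : Rd R d -> R[i]) (g : Rd R d -> R) (q p r N : R).
Local Notation powf g q := (fun z => (g z `^ q)%R).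

Lemma cmod_ge0 (z : R[i]) : 0 <= cmod z.
Proof. by case: z => a b; exact: sqrtr_ge0. Qed.

Lemma ball_mass_off_null (Z : set (Rd R d)) (h1 h2 : Rd R d -> R) y r :
  measurable Z -> mu Z = 0%E -> (forall z, ~ Z z -> h1 z = h2 z) ->
  ball_mass h1 y r = ball_mass h2 y r.
Proof.
move=> mZ Z0 h12; apply: (eq_integral_off_null mZ Z0) => x _ nZ.
by rewrite h12.
Qed.

(** The inner norm is [W(y, r)^(1/q)], and its [p]-th power is [W(y, r)^(p/q)]. The null set [Z]
    disappears inside each inner integral, so the inner norms agree for every [y]. *)
Lemma amalgam_normE r q p f g Z : 0 < q -> 0 < p ->
  measurable Z -> mu Z = 0%E -> (forall z, ~ Z z -> cmod (f z) = g z) ->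
  amalgam_norm r q%:E p%:E f =
  ((\int[mu]_y (ball_mass (powf g q) y r `^ (p / q))) `^ p^-1)%E.
Proof.
move=> q0 p0 mZ Z0 fg.
have fgq z : ~ Z z -> cmod (f z) `^ q = g z `^ q by move=> /fg ->.
rewrite /amalgam_norm unlock /=; congr (_ `^ _)%E.
apply: eq_integral => y _; rewrite gee0_abs ?poweR_ge0//.
rewrite -poweRrM (mulrC q^-1); apply: (congr1 (fun u => poweR u (p / q))).
rewrite -(ball_mass_off_null y r mZ Z0 fgq) ball_massE; last first.
  by move=> z; exact: powR_ge0.
apply: eq_integral => x _; congr EFin.
rewrite ger0_norm; last by rewrite mulr_ge0// cmod_ge0.
rewrite powRM ?cmod_ge0//; congr (_ * _).
rewrite indicE /eball; case: (ltP (edist y x) r) => h.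
  by rewrite mem_set ?powR1//= edistC.
by rewrite memNset ?powR0 ?gt_eqF//= edistC => /(le_lt_trans h); rewrite ltxx.
Qed.

Lemma amalgam_bound_of_norm q p N (phi : R -> R) f g Z : 0 < q -> 0 < p ->
  0 < N -> (forall t, 0 < t -> 0 < phi t) ->
  measurable Z -> mu Z = 0%E -> (forall z, ~ Z z -> cmod (f z) = g z) ->
  (fofana_norm phi q%:E p%:E f <= N%:E)%E -> amalgam_bound q p phi g N.
Proof.
move=> q0 p0 N0 phi_gt0 mZ Z0 fg fN t t0.
have pt := phi_gt0 _ t0; have td : 0 < t ^+ d by rewrite exprn_gt0.
have : (((phi t)^-1 * t `^ (d%:R * (- q^-1 - p^-1)))%:E *
    amalgam_norm t q%:E p%:E f <= N%:E)%E.
  by apply: le_trans fN; apply: ereal_sup_ubound; exists t.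
rewrite (amalgam_normE t q0 p0 mZ Z0 fg).
set I := (\int[mu]_y _)%E.
have I0 : (0 <= I)%E by apply: integral_ge0 => y _; exact: poweR_ge0.
have tE : t `^ (d%:R * (- q^-1 - p^-1)) =
    ((t ^+ d) `^ q^-1 * (t ^+ d) `^ p^-1)^-1.
  rewrite -powRD ?(gt_eqF td) ?implybT// -powRN opprD -powR_mulrn ?(ltW t0)//.
  by rewrite -powRrM.
have c0 : 0 < phi t * ((t ^+ d) `^ q^-1 * (t ^+ d) `^ p^-1).
  by rewrite !mulr_gt0// powR_gt0.
rewrite tE -invfM muleC lee_pdivrMr// => H.
have pi0 : 0 < p^-1 by rewrite invr_gt0.
apply: (poweR_le_inv pi0) => //.
  by rewrite lee_fin !mulr_ge0 ?powR_ge0// ltW.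
apply: (le_trans H); rewrite -EFinM poweR_EFin lee_fin.
rewrite !(powRM _ (powR_ge0 _ _)) ?mulr_ge0 ?powR_ge0 ?(ltW td)// -!powRrM.
rewrite (_ : p * p^-1 = 1) ?divff ?gt_eqF// powRr1; last first.
  by rewrite mulr_ge0// ltW.
rewrite (_ : p / q / p = q^-1); last by field; rewrite !gt_eqF.
by rewrite -[leRHS]mulrA.
Qed.

End amalgam_norms.

(** * Signed kernel integrals and their majorants *)

Section kernel_integrals.
Variables (R : realType) (d : nat) (k : Rd R d -> Rd R d -> R).
Local Notation mu := (lebesgueRd R d).
Implicit Types (x y z : Rd R d) (g u : Rd R d -> R).
Hypothesis k_ge0 : forall x z, 0 <= k x z.
Hypothesis mk : forall disp (T : measurableType disp) (f g : T -> Rd R d),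
  measurable_fun setT f -> measurable_fun setT g ->
  measurable_fun setT (fun a => k (f a) (g a)).

(** Tonelli applies to the positive and the negative part separately; their difference and its real
    value under [fine] are measurable whether or not the integrals converge. *)
Lemma measurable_kernel_integral u : measurable_fun setT u ->
  measurable_fun setT (fun x => (\int[mu]_y (k x y * u y))%R).
Proof.
move=> mf; pose F (a : Rd R d * Rd R d) : \bar R := (k a.1 a.2 * u a.2)%:E.
have mF : measurable_fun setT F.
  apply/measurable_EFinP; apply: measurable_funM; first exact: mk.
  exact: measurableT_comp.
apply: (@measurableT_comp _ _ _ _ _ _ (fine : \bar R -> R)) => //.
have mFp : measurable_fun setT (fun x => \int[mu]_y (F ^\+ (x, y)))%E.
  apply: (@measurable_fun_fubini_tonelli_F _ _ _ _ _ mu (fun a => (F ^\+) a)%E) => //.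
  exact: measurable_funepos.
have mFn : measurable_fun setT (fun x => \int[mu]_y (F ^\- (x, y)))%E.
  apply: (@measurable_fun_fubini_tonelli_F _ _ _ _ _ mu (fun a => (F ^\-) a)%E) => //.
  exact: measurable_funeneg.
rewrite [X in measurable_fun _ X](_ : _ = (fun x => \int[mu]_y (F ^\+ (x, y)) -
    \int[mu]_y (F ^\- (x, y)))%E); first exact: emeasurable_funB.
apply/funext => x; rewrite (integralE mu setT).
by congr (_ - _)%E; apply: eq_integral => y _; rewrite ?funeposE ?funenegE.
Qed.

(** Valid at every [x]: where the signed integral is infinite, [fine] returns [0]. *)
Lemma kernel_integral_le_potential u g x : measurable_fun setT u ->
  (forall z, `|u z| <= g z) ->
  (`|(\int[mu]_y (k x y * u y))%R|%:E <= potential k g x)%E.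
Proof.
move=> mf ug; rewrite /Rintegral.
have mF : measurable_fun setT (EFin \o (fun y => k x y * u y)).
  by apply/measurable_EFinP; apply: measurable_funM => //; exact: mk.
apply: (@le_trans _ _ (`|\int[mu]_y (k x y * u y)%:E|)%E).
  by case: (\int[mu]_y _)%E => [s||] //=; rewrite normr0 ?leey.
apply: (le_trans (le_abse_integral mu measurableT mF)).
apply: le_integral_nonneg => y _; first exact: abse_ge0.
by rewrite /= lee_fin normrM (ger0_norm (k_ge0 _ _)) ler_wpM2l.
Qed.

End kernel_integrals.

Lemma cmod_le_normD (R : realType) (a b : R) : cmod (Complex a b) <= `|a| + `|b|.
Proof.
rewrite /cmod /=; rewrite -(@ler_sqr R) ?nnegrE ?sqrtr_ge0 ?addr_ge0//.
rewrite sqr_sqrtr ?addr_ge0 ?sqr_ge0// sqrrD !real_normK ?num_real//.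
by rewrite -subr_ge0 (_ : _ - _ = `|a| * `|b| *+ 2) ?mulrn_wge0 ?mulr_ge0//; ring.
Qed.

Section representatives.
Variables (R : realType) (d : nat).
Local Notation mu := (lebesgueRd R d).
Implicit Types (f : Rd R d -> R[i]) (g u v : Rd R d -> R).

Lemma L0_representative f : L0 f -> exists u v Z,
  [/\ measurable_fun setT u, measurable_fun setT v, measurable Z, mu Z = 0%E &
      forall z, ~ Z z -> f z = Complex (u z) (v z)].
Proof.
move=> [/(completed_measurable_fun_off_null measurableT)[A [mA A0 mRe]]].
move=> /(completed_measurable_fun_off_null measurableT)[B [mB B0 mIm]].
have mAC : measurable (setT `\` A) by exact: measurableD.
have mBC : measurable (setT `\` B) by exact: measurableD.
exists ((fun z => complex.Re (f z)) \_ (setT `\` A)).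
exists ((fun z => complex.Im (f z)) \_ (setT `\` B)).
exists (A `|` B); split.
- exact/(measurable_restrictT _ _).1.
- exact/(measurable_restrictT _ _).1.
- exact: measurableU.
- by apply/eqP; rewrite -measure_le0 -[leRHS]adde0 -[X in (_ <= X + _)%E]A0 -[X in (_ <= _ + X)%E]B0 measureU2.
move=> z nZ; rewrite !patchE !mem_set.
- by case: (f z).
- by split => // Bz; apply: nZ; right.
- by split => // Az; apply: nZ; left.
Qed.

Lemma measurable_L0 f :
  measurable_fun setT (fun z => complex.Re (f z)) ->
  measurable_fun setT (fun z => complex.Im (f z)) -> L0 f.
Proof.
move=> mRe mIm.
have sub (A : set (Rd R d)) : measurable A ->
    (completed_algebra_gen mu).-sigma.-measurable A.
  move=> mA; apply: sub_sigma_algebra; exists A => //; exists set0.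
    exact: negligible_set0.
  by rewrite setU0.
by split => _ Y mY; apply: sub; [exact: mRe|exact: mIm].
Qed.

End representatives.

Section fofana_norms.
Variables (R : realType) (d : nat).
Local Notation mu := (lebesgueRd R d).
Implicit Types (f : Rd R d -> R[i]) (q p r C L : R).

Lemma fofana_norm_ge0 phi q p f : pos_valued phi ->
  (0 <= fofana_norm phi q%:E p%:E f)%E.
Proof.
move=> phi_gt0; have p1 := phi_gt0 1 ltr01.
apply: (@le_trans _ _ (((phi 1)^-1 * 1 `^ (d%:R * (- einv q%:E - einv p%:E)))%:E *
    amalgam_norm 1 q%:E p%:E f)%E); last first.
  by apply: ereal_sup_ubound; exists 1 => //=.
rewrite mule_ge0 ?lee_fin ?mulr_ge0 ?powR_ge0 ?invr_ge0 ?(ltW p1)//.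
exact: Lnorm_ge0.
Qed.

(** The way back from integral bounds to norms, with a majorant [X] in place of the modulus. Only
    one-sided integral inequalities are used, so [f] and [X] may be arbitrary functions. *)
Lemma fofana_norm_le psi q p C L f (X : Rd R d -> \bar R) :
  0 < q -> 0 < p -> pos_valued psi -> 0 <= C -> 0 < L ->
  (forall x, (0 <= X x)%E) -> (forall x, ((cmod (f x))%:E <= L%:E * X x)%E) ->
  (forall r, 0 < r ->
    (\int[mu]_y ((\int[mu]_(x in eball y r) (X x `^ q)) `^ (p / q)) <=
     ((C * psi r) `^ p * ((r ^+ d) `^ (p / q) * r ^+ d))%:E)%E) ->
  (fofana_norm psi q%:E p%:E f <= (L * C)%:E)%E.
Proof.
move=> q0 p0 psi_gt0 C0 L0 X0 fX HX.
apply: ge_ereal_sup => _ [r /= r0 <-]; have pr := psi_gt0 _ r0.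
have rd : 0 < r ^+ d by rewrite exprn_gt0.
rewrite (amalgam_normE (g := fun z => cmod (f z)) r q0 p0 measurable0)//.
have qp0 : 0 <= p / q by rewrite divr_ge0 ?ltW.
have Lq : 0 < L `^ q by rewrite powR_gt0.
have Lqp : 0 < (L `^ q) `^ (p / q) by rewrite powR_gt0.
have ptw y : (ball_mass (fun z => (cmod (f z) `^ q)%R) y r `^ (p / q) <=
   ((L `^ q) `^ (p / q))%:E * (\int[mu]_(x in eball y r) (X x `^ q)) `^ (p / q))%E.
  have J0 : (0 <= \int[mu]_(x in eball y r) (X x `^ q))%E.
    by apply: integral_ge0 => x _; exact: poweR_ge0.
  have L0' : (0 <= (L `^ q)%:E)%E by rewrite lee_fin ltW.
  rewrite -poweR_EFin -(poweRM _ L0' J0).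
  apply: lee_poweR => //.
    by apply: ball_mass_ge0 => z; exact: powR_ge0.
  apply: (le_trans _ (integralZl_le_nonneg _ Lq _)) => [|x _]; last exact: poweR_ge0.
  apply: le_integral_nonneg => x _; first by rewrite lee_fin powR_ge0.
  rewrite -!poweR_EFin -poweRM ?lee_fin ?(ltW L0)//.
  by apply: lee_poweR (fX x); rewrite ?lee_fin ?cmod_ge0// ltW.
set I := (\int[mu]_y _)%E.
have I0 : (0 <= I)%E by apply: integral_ge0 => y _; exact: poweR_ge0.
have IL : (I <= ((L * C * psi r) `^ p * ((r ^+ d) `^ (p / q) * r ^+ d))%:E)%E.
  apply: (le_trans (le_integral_nonneg mu (fun y _ => poweR_ge0 _ _) (fun y _ => ptw y))).
  apply: (le_trans (integralZl_le_nonneg _ Lqp _)) => [y _|]; first exact: poweR_ge0.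
  apply: (le_trans (lee_wpmul2l _ (HX r r0))); first by rewrite lee_fin ltW.
  rewrite -EFinM lee_fin -powRrM (_ : q * (p / q) = p); last first.
    by field; rewrite gt_eqF.
  have Cp : 0 <= C * psi r by rewrite mulr_ge0// ltW.
  by rewrite -(mulrA L) (powRM _ (ltW L0) Cp) -[leRHS]mulrA.
have pi0 : 0 <= p^-1 by rewrite invr_ge0 ltW.
have := lee_poweR pi0 I0 IL.
have LC0 : 0 <= L * C * psi r by rewrite !mulr_ge0 ?(ltW L0) ?(ltW pr).
have -> : (((L * C * psi r) `^ p * ((r ^+ d) `^ (p / q) * r ^+ d))%:E `^ p^-1 =
   (L * C * psi r * ((r ^+ d) `^ q^-1 * (r ^+ d) `^ p^-1))%:E)%E.
  rewrite poweR_EFin; congr EFin.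
  rewrite !(powRM _ (powR_ge0 _ _)) ?mulr_ge0 ?powR_ge0 ?(ltW rd)// -!powRrM.
  rewrite divff ?gt_eqF// powRr1//.
  by rewrite (_ : p / q / p = q^-1)//; field; rewrite !gt_eqF.
have -> : r `^ (d%:R * (- einv q%:E - einv p%:E)) =
    ((r ^+ d) `^ q^-1 * (r ^+ d) `^ p^-1)^-1.
  rewrite -powRD ?(gt_eqF rd) ?implybT// -powRN opprD -powR_mulrn ?(ltW r0)//.
  by rewrite -powRrM.
have c0 : 0 < psi r * ((r ^+ d) `^ q^-1 * (r ^+ d) `^ p^-1).
  by rewrite !mulr_gt0// powR_gt0.
rewrite -invfM muleC lee_pdivrMr// -EFinM => /le_trans; apply.
by rewrite lee_fin (mulrA (L * C)).
Qed.

End fofana_norms.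

(** * Replacing [rho] and [f] by Borel representatives *)

Section changing_the_kernel.
Variables (R : realType) (d : nat) (rho rho0 : R -> R).
Variable N : set (measurableTypeR R).
Local Notation mu := (lebesgueRd R d).
Hypotheses (hd : (0 < d)%N) (mN : measurable N) (N0 : lebesgue_measure N = 0%E).
Hypothesis rho0E : forall t, 0 < t -> ~ N t -> rho0 t = rho t.

(** [Z] depends on [x], but [T_rho f x] is an integral in [y] for fixed [x], so the two kernels give
    the same value at every [x]. At [y = x] both quotients are [0], the inverse of [0] being [0]. *)
Lemma frac_kernel_off_null (x : Rd R d) : exists Z,
  [/\ measurable Z, mu Z = 0%E &
      forall y, ~ Z y -> frac_kernel rho x y = frac_kernel rho0 x y].
Proof.
exists [set y | N (edist x y)]; split.
- rewrite -[X in measurable X]setTI.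
  have h : measurable_fun setT (fun y : Rd R d => edist x y : measurableTypeR R).
    exact: measurable_fun_edist.
  exact: (h measurableT).
- by case: d hd x => // d' _ x; exact: null_preimage_edist.
move=> y /= nN; rewrite /frac_kernel.
have := edist_ge0 x y; rewrite le_eqVlt => /predU1P[<-|xy]; last by rewrite rho0E.
by rewrite expr0n gtn_eqF//= invr0 !mulr0.
Qed.

Variables (f : Rd R d -> R[i]) (u v : Rd R d -> R) (Z : set (Rd R d)).
Hypotheses (mZ : measurable Z) (Z0 : mu Z = 0%E).
Hypothesis fE : forall z, ~ Z z -> f z = Complex (u z) (v z).

Let kernel_integralE (h h' : Rd R d -> R) x : (forall z, ~ Z z -> h z = h' z) ->
  (\int[mu]_y (frac_kernel rho x y * h y)%:E =
   \int[mu]_y (frac_kernel rho0 x y * h' y)%:E)%E.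
Proof.
move=> hh'; have [A [mA A0 kA]] := frac_kernel_off_null x.
apply: (@eq_integral_off_null _ _ _ _ _ (A `|` Z)).
- exact: measurableU.
- rewrite measureU0//.
by move=> y _ nAZ; rewrite kA ?hh'// => ?; apply: nAZ; [right|left].
Qed.

Lemma T_rhoE x : T_rho rho f x =
  Complex (\int[mu]_y (frac_kernel rho0 x y * u y))%R
          (\int[mu]_y (frac_kernel rho0 x y * v y))%R.
Proof.
by rewrite /T_rho /Rintegral; congr Complex; congr fine;
  apply: kernel_integralE => z /fE ->.
Qed.

Lemma T_rho_definedE x : T_rho_defined rho f x =
  (potential (frac_kernel rho0) (fun z => cmod (Complex (u z) (v z))) x < +oo)%E.
Proof.
by rewrite /T_rho_defined (kernel_integralE (h' := fun z => cmod (Complex (u z) (v z))))// => z /fE ->.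
Qed.

End changing_the_kernel.

(** * Boundedness of [T_rho] between generalized Fofana spaces *)

Theorem theorem4p3 (R : realType) (d : nat) (hd : (0 < d)%N)
    (q p : R) (hq : 1 < q) (hqp : q <= p)
    (phi : R -> R) (hphi : Gclass d q%:E p%:E phi)
    (hsurj : set_surj `]0, +oo[ `]0, +oo[ phi)
    (hphi_int : exists2 C : R, 0 < C & forall r : R, 0 < r ->
      (\int[lebesgue_measure]_(t in `]r, +oo[)
         (phi t `^ q * t `^ (d%:R * q / p - 1))%:E
       <= (C * (phi r `^ q * r `^ (d%:R * q / p)))%:E)%E)
    (rho : R -> R) (hrho : pos_valued rho)
    (hrho_meas : completed_measurable_fun lebesgue_measure `]0, +oo[ rho)
    (hrho_doubling : doubling rho)
    (qb pb : R) (hqb : 0 < qb) (hpb : 0 < pb)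
    (hratio : q / qb = p / pb) (hratio1 : q / qb < 1)
    (hrho_phi : exists2 C' : R, 0 < C' & forall r : R, 0 < r ->
      (\int[lebesgue_measure]_(t in `]0%R, r[) (rho t / t)%:E
         <= (C' * phi r `^ (q / qb - 1))%:E)%E /\
      (\int[lebesgue_measure]_(t in `]r, +oo[) (rho t * phi t / t)%:E
         <= (C' * phi r `^ (q / qb))%:E)%E) :
  exists2 K : R, 0 < K &
    forall f : d.-tuple (measurableTypeR R) -> R[i],
      fofana_space phi q%:E p%:E f ->
      [/\ {ae lebesgueRd R d, forall x, T_rho_defined rho f x},
          L0 (T_rho rho f) &
          (fofana_norm (fun r : R => (phi r `^ (q / qb))%R) qb%:E pb%:E (T_rho rho f)
           <= K%:E * fofana_norm phi q%:E p%:E f)%E].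
Proof.
have q0 : 0 < q by exact: lt_trans hq.
have p0 : 0 < p by exact: lt_le_trans hqp.
(* For this exponent [q / e = qb] and [p / e = pb], so the estimates for potentials end in the
   target space. *)
pose e := q / qb.
have e0 : 0 < e by rewrite divr_gt0.
have qe : q / e = qb by rewrite /e; field; rewrite !gt_eqF.
have pe : p / e = pb by rewrite /e hratio; field; rewrite !gt_eqF.
have pq : pb / qb = p / q.
  by rewrite -qe -pe; field; rewrite !gt_eqF.
have [phi_pos [D D0 phi_adec] _] := hphi.
have phi_gt0 t : 0 < t -> 0 < phi t by exact: phi_pos.
have phi_dec s t : 0 < s -> s <= t ->
    phi t * t `^ (d%:R / p) <= D * (phi s * s `^ (d%:R / p)) by exact: phi_adec.
have [C C0 phi_int] := hphi_int.
have [B B0 rho_phi] := hrho_phi.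
have phiD := almost_decreasing_of_weighted q0 hqp phi_gt0 phi_dec.
have phi_tail := growth_function_tail q0 hqp D0 phi_gt0 phi_dec (ltW C0) phi_int.
have [rho0 [N [mrho0 mN N0 rho0_ge0 [rho0_le rho0E [C1 C10 rhoC]]]]] :=
  doubling_measurable hrho hrho_doubling hrho_meas.
pose k := @frac_kernel R d rho0.
(* A Borel function comparable to [phi]: the measurable minorant of the almost decreasing
   [phi t * t^(d/p)], divided by the weight. *)
have [phi0 [mphi0 phi0_ge0 [D' D'0 phi0P]]] :
    exists phi0 : R -> R, [/\ measurable_fun setT phi0, (forall t, 0 <= phi0 t) &
      exists2 D', 0 < D' & forall t, 0 < t -> phi0 t <= phi t <= D' * phi0 t].
  have [||g0 [mg0 g0_ge0 [D' D'0 g0P]]] :=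
    @almost_decreasing_measurable R (fun t => phi t * t `^ (d%:R / p)).
  - by move=> t t0; apply: mulr_gt0; [exact: phi_gt0|exact: powR_gt0].
  - by exists D.
  exists (fun t => g0 t * t `^ (- (d%:R / p))); split.
  - by apply: measurable_funM => //; exact: measurable_fun_powR_cst.
  - by move=> t; rewrite mulr_ge0// powR_ge0.
  exists D' => // t t0; have tp : 0 < t `^ (d%:R / p) by rewrite powR_gt0.
  have /andP[h1 h2] := g0P t t0.
  rewrite powRN; apply/andP; split; first by rewrite ler_pdivrMr.
  by rewrite mulrA ler_pdivlMr.
have [K1 [K10 near far]] : exists K, [/\ 0 <= K, near_bound k phi e K & far_bound k phi e K].
  pose Kn := C1 * 2 ^+ d.+2 * B; pose Kf := C1 * 2 ^+ d.+2 * D' * B.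
  have C2 : 0 <= C1 * 2 ^+ d.+2 by rewrite mulr_ge0 ?exprn_ge0// ltW.
  have Kn0 : 0 <= Kn by rewrite mulr_ge0// ltW.
  have Kf0 : 0 <= Kf by rewrite mulr_ge0 ?(ltW B0)// mulr_ge0// ltW.
  exists (Kn + Kf); split; first exact: addr_ge0.
    apply: (@near_bound_le _ _ _ _ _ Kn); first by rewrite lerDl.
    apply: (frac_kernel_near_bound hd mrho0 rho0_ge0 mN N0 C10 rhoC) => s s0.
    apply: le_trans (rho_phi s s0).1; apply: le_integral_nonneg => t /=.
      by rewrite in_itv/= => /andP[t0 _]; rewrite lee_fin divr_ge0// ltW.
    rewrite in_itv/= => /andP[t0 _].
    by rewrite lee_fin ler_wpM2r ?invr_ge0 ?(ltW t0)// rho0_le.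
  apply: (@far_bound_le _ _ _ _ _ Kf); first by rewrite lerDr.
  apply: (frac_kernel_far_bound hd mrho0 rho0_ge0 mN N0 C10 rhoC mphi0 phi0_ge0
    (ltW D'0)) => [t t0|s s0]; first by case/andP: (phi0P t t0).
  apply: le_trans (rho_phi s s0).2; apply: le_integral_nonneg => t /=.
    rewrite in_itv/= andbT => /(lt_trans s0) t0.
    by rewrite lee_fin divr_ge0 ?mulr_ge0// ltW.
  rewrite in_itv/= andbT => /(lt_trans s0) t0.
  rewrite lee_fin ler_wpM2r ?invr_ge0 ?(ltW t0)// ler_pM ?rho0_le//.
  by case/andP: (phi0P t t0).
have k_ge0 : forall x z, 0 <= k x z by exact: kernel_ge0.
have kC : forall x z, k x z = k z x by exact: kernelC.
have mk disp (T : measurableType disp) (a b : T -> Rd R d) :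
    measurable_fun setT a -> measurable_fun setT b ->
    measurable_fun setT (fun z => k (a z) (b z)) by exact: measurable_fun_kernel.
have T0 : 0 <= D `^ (p - q) * C by rewrite mulr_ge0 ?powR_ge0// ltW.
have finite := potential_ae_finite hq hqp D0 phi_gt0 phiD k_ge0 kC mk hsurj
  e0 K10 near far.
have [A A0 bound] := potential_global_bound hq hqp D0 T0 phi_gt0 phiD phi_tail
  k_ge0 kC mk hsurj e0 K10 near far.
clear near far.
(* The [pb]-th root undoes the power in the global bound; the factor [2] below comes from adding the
   real and imaginary parts. *)
pose A' := A `^ pb^-1.
have A'0 : 0 < A' by rewrite powR_gt0.
exists (2 * A'); first by rewrite mulr_gt0.
move=> f [/L0_representative[u [v [Z [mu_ mv mZ Z0 fE]]]] fN].
pose g z := cmod (Complex (u z) (v z)).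
have g0 z : 0 <= g z by exact: cmod_ge0.
have mg : measurable_fun setT g.
  apply: measurable_fun_sqrt; apply: measurable_funD; exact: measurable_funX.
have fg z : ~ Z z -> cmod (f z) = g z by move=> /fE ->.
have gN M : 0 < M -> (fofana_norm phi q%:E p%:E f <= M%:E)%E ->
    amalgam_bound q p phi g M.
  by move=> M0; exact: (amalgam_bound_of_norm q0 p0 M0 phi_gt0 mZ Z0 fg).
have n0 := fofana_norm_ge0 q p f phi_gt0.
have nfin : fofana_norm phi q%:E p%:E f \is a fin_num by rewrite ge0_fin_numE.
pose n := fine (fofana_norm phi q%:E p%:E f).
have n0' : 0 <= n by exact: fine_ge0.
have nE : fofana_norm phi q%:E p%:E f = n%:E by rewrite fineK.
have TE := T_rhoE hd mN N0 rho0E mZ Z0 fE.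
split.
- have M0 : 0 < n + 1 by rewrite ltr_wpDl.
  have := finite g (n + 1) mg g0 M0.
  have nM : (fofana_norm phi q%:E p%:E f <= (n + 1)%:E)%E by rewrite nE lee_fin lerDl.
  move=> /(_ (gN _ M0 nM)); apply: filterS => x.
  by rewrite (T_rho_definedE hd mN N0 rho0E mZ Z0 fE).
- apply: measurable_L0.
    rewrite [X in measurable_fun _ X](_ : _ = (fun x => (\int[lebesgueRd R d]_y (k x y * u y))%R)).
      exact: measurable_kernel_integral.
    by apply/funext => x; rewrite TE.
  rewrite [X in measurable_fun _ X](_ : _ = (fun x => (\int[lebesgueRd R d]_y (k x y * v y))%R)).
    exact: measurable_kernel_integral.
  by apply/funext => x; rewrite TE.
have Tpot x : ((cmod (T_rho rho f x))%:E <= 2%:E * potential k g x)%E.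
  have cmod_Re z : `|u z| <= g z.
    rewrite -ler_sqr ?nnegrE// sqr_sqrtr ?addr_ge0 ?sqr_ge0// real_normK ?num_real//.
    by rewrite lerDl sqr_ge0.
  have cmod_Im z : `|v z| <= g z.
    rewrite -ler_sqr ?nnegrE// sqr_sqrtr ?addr_ge0 ?sqr_ge0// real_normK ?num_real//.
    by rewrite lerDr sqr_ge0.
  rewrite TE; apply: (@le_trans _ _ (`|(\int[lebesgueRd R d]_y (k x y * u y))%R|%:E +
     `|(\int[lebesgueRd R d]_y (k x y * v y))%R|%:E)%E).
    by rewrite -EFinD lee_fin cmod_le_normD.
  have := leeD (kernel_integral_le_potential k_ge0 mk x mu_ cmod_Re)
    (kernel_integral_le_potential k_ge0 mk x mv cmod_Im).
  by move=> /le_trans; apply; rewrite -[leRHS]/((1 + 1)%R%:E * _)%E (EFinD 1 1) ge0_muleDl// !mul1e.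
have psi_gt0 : pos_valued (fun r => phi r `^ (q / qb)).
  by move=> t t0; rewrite powR_gt0// phi_gt0.
have pot0 x : (0 <= potential k g x)%E by exact: potential_ge0.
rewrite nE -EFinM; apply/lee_addgt0Pr => eps eps0.
(* The norm [n] may be [0] while amalgam bounds are used with [M > 0]; the excess is chosen so that
   [2 * A' * M = 2 * A' * n + eps]. *)
pose M := n + eps / (2 * A').
have M0 : 0 < M by rewrite ltr_wpDl// divr_gt0// mulr_gt0.
have nM : (fofana_norm phi q%:E p%:E f <= M%:E)%E.
  by rewrite nE lee_fin lerDl divr_ge0 ?mulr_ge0 ?(ltW A'0)// ltW.
have -> : ((2 * A' * n)%:E + eps%:E)%E = (2 * (A' * M))%:E.
  rewrite -EFinD /M; congr EFin; field.
  by rewrite gt_eqF.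
apply: (fofana_norm_le hqb hpb psi_gt0 _ _ pot0 Tpot) => //.
  by rewrite mulr_ge0 ?(ltW A'0)// ltW.
move=> r r0; have := bound g M r mg g0 M0 r0 (gN _ M0 nM).
rewrite qe pe pq => /le_trans; apply.
have pr := phi_gt0 r r0.
rewrite lee_fin le_eqVlt; apply/orP; left; apply/eqP; congr (_ * _).
rewrite powRM ?powR_ge0 ?mulr_ge0 ?(ltW A'0) ?(ltW M0)// powRM ?(ltW A'0) ?(ltW M0)//.
rewrite /A' -!powRrM mulVf ?gt_eqF// powRr1 ?(ltW A0)//.
(* The equality of the two ratios gives [(phi^(q/qb))^pb = phi^p]. *)
by rewrite hratio divfK ?gt_eqF.
Qed.
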